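(* Let $n\ge1$ and let $f\not\equiv0$ be a binary $n$-ic form with integer coefficients, with associated subscheme $S_f\subset\mathbb{P}^1_{\mathbb{Z}}$. Then the ring $\Gamma(\mathcal{O}_{S_f})$ of global functions of $S_f$ is isomorphic to $R_f$. The global sections $\Gamma(\mathcal{O}_{S_f}(k))$ have a $\Gamma(\mathcal{O}_{S_f})$-module structure, and via $R_f\cong\Gamma(\mathcal{O}_{S_f})$ this gives $\Gamma(\mathcal{O}_{S_f}(k))$ an $R_f$-module structure. For $1\le k\le n-1$, $\Gamma(\mathcal{O}_{S_f}(k))$ is isomorphic to $I_f^k$ as an $R_f$-module, and $\Gamma(\mathcal{O}_{S_f}(-1))$ is isomorphic to $I_f^\#$ as an $R_f$-module.
   Context: A binary $n$-ic form is $f=f_0x^n+f_1x^{n-1}y+\dots+f_ny^n$ with $f_i\in\mathbb{Z}$. $S_f$ is the closed subscheme of $\mathbb{P}^1_{\mathbb{Z}}=\operatorname{Proj}\mathbb{Z}[x,y]$ cut out by $f$; $\mathcal{O}_{S_f}(k)$ is the pullback of $\mathcal{O}(k)$ to $S_f$; $\Gamma$ denotes global sections. If $f_0\neq0$, put $Q_f=\mathbb{Q}[\theta]/(f_0\theta^n+f_1\theta^{n-1}+\dots+f_n)$, $\zeta_0=1$, and $\zeta_k=f_0\theta^k+f_1\theta^{k-1}+\dots+f_{k-1}\theta$ for $1\le k\le n-1$. $R_f$ is the $\mathbb{Z}$-span of $\zeta_0,\dots,\zeta_{n-1}$, a subring of $Q_f$. $I_f=(1,\theta)$ is the $R_f$-submodule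 of $Q_f$ generated by $1,\theta$, and $I_f^k$ is its $k$-th power as a fractional ideal. $I_f^\#$ is the $\mathbb{Z}$-span of $f_0,\ f_0\theta+f_1,\dots,\ f_0\theta^{n-1}+f_1\theta^{n-2}+\dots+f_{n-1}$, an ideal of $R_f$. If $f\ne0$ but $f_0=0$, the ring $R_f$ and the ideal classes of $I_f^k$, $I_f^\#$ are defined as those of $f'$, for any $GL_2(\mathbb{Z})$-transform $f'$ of $f$ (by linear substitution of variables) with nonzero $x^n$-coefficient; the choice does not matter up to isomorphism. *)

(* Defs.v *)
From HB Require Import structures.
From mathcomp Require Import all_boot all_order all_algebra.
From mathcomp Require Import boolp.
From mathcomp Require Import generic_quotient mpoly ring zify.

Set Implicit Arguments.
Unset Strict Implicit.
Unset Printing Implicit Defensive.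

Import GRing.Theory.
Local Open Scope ring_scope.
Local Open Scope quotient_scope.

(* R_f and the global functions of S_f are given as subrings S of an ambient
   ring A, and the R_f- and Gamma(O)-modules as S-submodules of A. *)

Record subring (A : comPzRingType) := Subring {
  sr_set :> A -> Prop;
  sr_1 : sr_set 1;
  sr_B : forall x y, sr_set x -> sr_set y -> sr_set (x - y);
  sr_M : forall x y, sr_set x -> sr_set y -> sr_set (x * y) }.

Definition sr_pred (A : comPzRingType) (S : subring A) : {pred A} :=
  fun x => `[< S x >].

Lemma sr_predP (A : comPzRingType) (S : subring A) x :
  (x \in sr_pred S) <-> S x.
Proof. by rewrite unfold_in; split=> /asboolP. Qed.

Lemma sr_closed (A : comPzRingType) (S : subring A) : subring_closed (sr_pred S).
Proof.
split=> [|x y|x y].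
- exact/sr_predP/sr_1.
- by move=> /sr_predP Sx /sr_predP Sy; apply/sr_predP/sr_B.
- by move=> /sr_predP Sx /sr_predP Sy; apply/sr_predP/sr_M.
Qed.

HB.instance Definition _ (A : comPzRingType) (S : subring A) :=
  GRing.isSubringClosed.Build A (sr_pred S) (sr_closed S).

Record sr_type (A : comPzRingType) (S : subring A) : Type := SrType {
  sr_val : A;
  _ : sr_val \in sr_pred S }.
Coercion sr_type : subring >-> Sortclass.

HB.instance Definition _ (A : comPzRingType) (S : subring A) :=
  [isSub for @sr_val A S].
HB.instance Definition _ (A : comPzRingType) (S : subring A) :=
  [Choice of sr_type S by <:].
HB.instance Definition _ (A : comPzRingType) (S : subring A) :=
  GRing.SubChoice_isSubComPzRing.Build A (sr_pred S) (sr_type S) (sr_closed S).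

Record submod (A : comPzRingType) (S : subring A) := Submod {
  sm_set :> A -> Prop;
  sm_0 : sm_set 0;
  sm_B : forall x y, sm_set x -> sm_set y -> sm_set (x - y);
  sm_Z : forall r x, S r -> sm_set x -> sm_set (r * x) }.

Definition sm_pred (A : comPzRingType) (S : subring A) (M : submod S) :
  {pred A} := fun x => `[< M x >].

Lemma sm_predP (A : comPzRingType) (S : subring A) (M : submod S) x :
  (x \in sm_pred M) <-> M x.
Proof. by rewrite unfold_in; split=> /asboolP. Qed.

Lemma sm_closed (A : comPzRingType) (S : subring A) (M : submod S) :
  zmod_closed (sm_pred M).
Proof.
split=> [|x y]; first exact/sm_predP/sm_0.
by move=> /sm_predP Mx /sm_predP My; apply/sm_predP/sm_B.
Qed.

HB.instance Definition _ (A : comPzRingType) (S : subring A) (M : submod S) :=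
  GRing.isZmodClosed.Build A (sm_pred M) (sm_closed M).

Record sm_type (A : comPzRingType) (S : subring A) (M : submod S) : Type := SmType {
  sm_val : A;
  _ : sm_val \in sm_pred M }.
Coercion sm_type : submod >-> Sortclass.

HB.instance Definition _ (A : comPzRingType) (S : subring A) (M : submod S) :=
  [isSub for @sm_val A S M].
HB.instance Definition _ (A : comPzRingType) (S : subring A) (M : submod S) :=
  [Choice of sm_type M by <:].
HB.instance Definition _ (A : comPzRingType) (S : subring A) (M : submod S) :=
  [SubChoice_isSubZmodule of sm_type M by <:].

Section SubmodScale.
Variables (A : comPzRingType) (S : subring A) (M : submod S).

Lemma sm_scale_subproof (r : S) (x : M) : val r * val x \in sm_pred M.
Proof. by apply/sm_predP/sm_Z; [apply/sr_predP/valP | apply/sm_predP/valP]. Qed.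

Definition sm_scale (r : S) (x : M) : M := SmType (sm_scale_subproof r x).

Lemma sm_scaleA a b v : sm_scale a (sm_scale b v) = sm_scale (a * b) v.
Proof. by apply: val_inj; rewrite /= mulrA. Qed.
Lemma sm_scale1 : left_id 1 sm_scale.
Proof. by move=> v; apply: val_inj; rewrite /= mul1r. Qed.
Lemma sm_scaleDr : right_distributive sm_scale +%R.
Proof. by move=> a u v; apply: val_inj; rewrite /= mulrDr. Qed.
Lemma sm_scaleDl v : {morph sm_scale^~ v : a b / a + b}.
Proof. by move=> a b; apply: val_inj; rewrite /= mulrDl. Qed.

HB.instance Definition _ := GRing.Zmodule_isLmodule.Build (sr_type S) (sm_type M)
  sm_scaleA sm_scale1 sm_scaleDr sm_scaleDl.

End SubmodScale.

Section SubmodMul.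
Variables (A : comPzRingType) (S : subring A).

Definition sm_mul_set (M N : A -> Prop) (x : A) : Prop :=
  exists (m : nat) (u v : 'I_m -> A),
    (forall i, M (u i) /\ N (v i)) /\ x = \sum_i u i * v i.

Lemma sm_mul0 (M N : submod S) : sm_mul_set M N 0.
Proof.
exists 0, (fun=> 0), (fun=> 0); split; last by rewrite big_ord0.
by case.
Qed.

Lemma sm_mulB (M N : submod S) x y :
  sm_mul_set M N x -> sm_mul_set M N y -> sm_mul_set M N (x - y).
Proof.
move=> [m [u [v [uv ->]]]] [m' [u' [v' [uv' ->]]]].
pose w (a : 'I_m -> A) (b : 'I_m' -> A) (i : 'I_(m + m')) :=
  match split i with inl j => a j | inr j => b j end.
exists (m + m')%N, (w u (fun i => - u' i)), (w v v'); split.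
  move=> i; rewrite /w; case: (split i) => j; first exact: uv.
  have [Mu Nv] := uv' j; split=> //.
  by rewrite -sub0r; apply: sm_B => //; apply: sm_0.
rewrite big_split_ord /=; congr (_ + _).
  apply: eq_bigr => i _; rewrite /w.
  by have := unsplitK (inl i : 'I_m + 'I_m') => /= ->.
rewrite -sumrN; apply: eq_bigr => i _; rewrite /w.
by have := unsplitK (inr i : 'I_m + 'I_m') => /= ->; rewrite mulNr.
Qed.

Lemma sm_mulZ (M N : submod S) r x :
  S r -> sm_mul_set M N x -> sm_mul_set M N (r * x).
Proof.
move=> Sr [m [u [v [uv ->]]]]; exists m, (fun i => r * u i), v; split.
  by move=> i; have [Mu Nv] := uv i; split=> //; apply: sm_Z.
by rewrite mulr_sumr; apply: eq_bigr => i _; rewrite mulrA.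
Qed.

Definition sm_mul (M N : submod S) : submod S :=
  Submod (sm_mul0 M N) (@sm_mulB M N) (@sm_mulZ M N).

Lemma sr_0 : S 0.
Proof. by rewrite -(subrr 1); apply: sr_B; apply: sr_1. Qed.

Definition sm_one : submod S := Submod sr_0 (@sr_B A S) (@sr_M A S).

Definition sm_exp (M : submod S) (k : nat) : submod S := iter k (sm_mul M) sm_one.

End SubmodMul.

Definition ringprod (I : Type) (L : I -> comPzRingType) : Type := forall i, L i.

Section RingProd.
Variables (I : Type) (L : I -> comPzRingType).
Local Notation P := (ringprod L).

HB.instance Definition _ := gen_eqMixin P.
HB.instance Definition _ := gen_choiceMixin P.

Let rext (s t : P) : (forall i, s i = t i) -> s = t.
Proof. by move=> st; apply/functional_extensionality_dep. Qed.

Definition rp_zero : P := fun i => 0.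
Definition rp_one : P := fun i => 1.
Definition rp_opp (s : P) : P := fun i => - s i.
Definition rp_add (s t : P) : P := fun i => s i + t i.
Definition rp_mul (s t : P) : P := fun i => s i * t i.

Fact rp_addA : associative rp_add.
Proof. by move=> s t u; apply: rext => i; apply: addrA. Qed.
Fact rp_addC : commutative rp_add.
Proof. by move=> s t; apply: rext => i; apply: addrC. Qed.
Fact rp_add0 : left_id rp_zero rp_add.
Proof. by move=> s; apply: rext => i; apply: add0r. Qed.
Fact rp_addN : left_inverse rp_zero rp_opp rp_add.
Proof. by move=> s; apply: rext => i; apply: addNr. Qed.
Fact rp_mulA : associative rp_mul.
Proof. by move=> s t u; apply: rext => i; apply: mulrA. Qed.
Fact rp_mulC : commutative rp_mul.
Proof. by move=> s t; apply: rext => i; apply: mulrC. Qed.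
Fact rp_mul1 : left_id rp_one rp_mul.
Proof. by move=> s; apply: rext => i; apply: mul1r. Qed.
Fact rp_mulDl : left_distributive rp_mul rp_add.
Proof. by move=> s t u; apply: rext => i; apply: mulrDl. Qed.

HB.instance Definition _ :=
  GRing.isZmodule.Build P rp_addA rp_addC rp_add0 rp_addN.
HB.instance Definition _ :=
  GRing.Zmodule_isComPzRing.Build P rp_mulA rp_mulC rp_mul1 rp_mulDl.

End RingProd.

(* The localization T^-1 (A / J) of a quotient is built in one step from the
   ideal J = ker and the multiplicative set T = den of A. *)

Record locdatum (A : comNzRingType) := LocDatum {
  ker : A -> Prop;
  den : A -> Prop;
  ker_0 : ker 0;
  ker_D : forall x y, ker x -> ker y -> ker (x + y);
  ker_M : forall a x, ker x -> ker (a * x);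
  den_1 : den 1;
  den_M : forall x y, den x -> den y -> den (x * y) }.

Section Localization.
Variables (A : comNzRingType) (L : locdatum A).

Definition prefrac : Type := (A * {g : A | `[< den L g >]})%type.
HB.instance Definition _ := Choice.on prefrac.

Definition frac_rel (x y : prefrac) : Prop :=
  exists2 u, den L u & ker L (u * (x.1 * val y.2 - y.1 * val x.2)).

Definition frac_relb (x y : prefrac) : bool := `[< frac_rel x y >].

Lemma denP (g : {g : A | `[< den L g >]}) : den L (val g).
Proof. exact/asboolP/(valP g). Qed.

Fact frac_rel_refl : reflexive frac_relb.
Proof.
move=> x; apply/asboolP; exists 1; first exact: den_1.
by rewrite subrr mulr0; apply: ker_0.
Qed.

Fact frac_rel_sym : ssrbool.symmetric frac_relb.
Proof.
have H x y : frac_rel x y -> frac_rel y x.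
  move=> [u du ku]; exists u => //.
  by rewrite -opprB mulrN -mulN1r; apply: ker_M.
by move=> x y; apply/asboolP/asboolP; apply: H.
Qed.

Fact frac_rel_trans : transitive frac_relb.
Proof.
move=> y x z /asboolP[u du ku] /asboolP[v dv kv]; apply/asboolP.
exists (u * v * val y.2); first by apply: den_M (denP _); apply: den_M.
have -> : u * v * val y.2 * (x.1 * val z.2 - z.1 * val x.2)
  = v * val z.2 * (u * (x.1 * val y.2 - y.1 * val x.2))
    + u * val x.2 * (v * (y.1 * val z.2 - z.1 * val y.2)).
  by ring.
by apply: ker_D; apply: ker_M.
Qed.

Canonical frac_equiv := EquivRel frac_relb frac_rel_refl frac_rel_sym frac_rel_trans.

Definition loc : Type := {eq_quot frac_equiv}.
HB.instance Definition _ := Choice.on loc.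

Definition mkfrac (a g : A) (dg : den L g) : prefrac := (a, exist _ g (asboolT dg)).

Definition qfrac (x : prefrac) : loc := \pi_({eq_quot frac_equiv}) x.

Lemma qfracP x y : qfrac x = qfrac y <-> frac_rel x y.
Proof. by split=> [/eqmodP/asboolP|H]; last exact/eqmodP/asboolP. Qed.

Lemma qfrac_ind (P : loc -> Prop) : (forall x, P (qfrac x)) -> forall x, P x.
Proof. by move=> H; elim/quotW. Qed.

Definition pf_opp (x : prefrac) : prefrac := (- x.1, x.2).
Definition pf_add (x y : prefrac) : prefrac :=
  mkfrac (x.1 * val y.2 + y.1 * val x.2) (den_M (denP x.2) (denP y.2)).
Definition pf_mul (x y : prefrac) : prefrac :=
  mkfrac (x.1 * y.1) (den_M (denP x.2) (denP y.2)).

Definition loc_zero : loc := qfrac (mkfrac 0 (den_1 L)).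
Definition loc_one : loc := qfrac (mkfrac 1 (den_1 L)).
Definition loc_opp (x : loc) : loc := qfrac (pf_opp (repr x)).
Definition loc_add (x y : loc) : loc := qfrac (pf_add (repr x) (repr y)).
Definition loc_mul (x y : loc) : loc := qfrac (pf_mul (repr x) (repr y)).

Lemma repr_qfrac x : frac_rel (repr (qfrac x)) x.
Proof. by apply/qfracP; apply: reprK. Qed.

Lemma qfrac_opp x : loc_opp (qfrac x) = qfrac (pf_opp x).
Proof.
apply/qfracP; have [u du ku] := repr_qfrac x; exists u => //=.
move: (repr _) ku => y ku.
have -> : u * (- y.1 * val x.2 - - x.1 * val y.2)
  = -1 * (u * (y.1 * val x.2 - x.1 * val y.2)) by ring.
exact: ker_M.
Qed.

Lemma qfrac_add x y : loc_add (qfrac x) (qfrac y) = qfrac (pf_add x y).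
Proof.
apply/qfracP; have [u du ku] := repr_qfrac x; have [v dv kv] := repr_qfrac y.
move: (repr (qfrac x)) (repr (qfrac y)) ku kv => x' y' ku kv.
exists (u * v) => /=; first exact: den_M.
have -> : u * v * ((x'.1 * val y'.2 + y'.1 * val x'.2) * (val x.2 * val y.2)
                   - (x.1 * val y.2 + y.1 * val x.2) * (val x'.2 * val y'.2))
  = v * val y'.2 * val y.2 * (u * (x'.1 * val x.2 - x.1 * val x'.2))
    + u * val x'.2 * val x.2 * (v * (y'.1 * val y.2 - y.1 * val y'.2)) by ring.
by apply: ker_D; apply: ker_M.
Qed.

Lemma qfrac_mul x y : loc_mul (qfrac x) (qfrac y) = qfrac (pf_mul x y).
Proof.
apply/qfracP; have [u du ku] := repr_qfrac x; have [v dv kv] := repr_qfrac y.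
move: (repr (qfrac x)) (repr (qfrac y)) ku kv => x' y' ku kv.
exists (u * v) => /=; first exact: den_M.
have -> : u * v * (x'.1 * y'.1 * (val x.2 * val y.2)
                   - x.1 * y.1 * (val x'.2 * val y'.2))
  = v * y'.1 * val y.2 * (u * (x'.1 * val x.2 - x.1 * val x'.2))
    + u * x.1 * val x'.2 * (v * (y'.1 * val y.2 - y.1 * val y'.2)) by ring.
by apply: ker_D; apply: ker_M.
Qed.

Lemma qfrac_eq x y : x.1 * val y.2 = y.1 * val x.2 -> qfrac x = qfrac y.
Proof.
move=> E; apply/qfracP; exists 1; first exact: den_1.
by rewrite E subrr mulr0; apply: ker_0.
Qed.

Fact loc_addA : associative loc_add.
Proof.
elim/qfrac_ind=> x; elim/qfrac_ind=> y; elim/qfrac_ind=> z.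
by rewrite !qfrac_add; apply: qfrac_eq => /=; ring.
Qed.
Fact loc_addC : commutative loc_add.
Proof.
elim/qfrac_ind=> x; elim/qfrac_ind=> y.
by rewrite !qfrac_add; apply: qfrac_eq => /=; ring.
Qed.
Fact loc_add0 : left_id loc_zero loc_add.
Proof. by elim/qfrac_ind=> x; rewrite qfrac_add; apply: qfrac_eq => /=; ring. Qed.
Fact loc_addN : left_inverse loc_zero loc_opp loc_add.
Proof.
elim/qfrac_ind=> x; rewrite qfrac_opp qfrac_add.
by apply: qfrac_eq => /=; ring.
Qed.
Fact loc_mulA : associative loc_mul.
Proof.
elim/qfrac_ind=> x; elim/qfrac_ind=> y; elim/qfrac_ind=> z.
by rewrite !qfrac_mul; apply: qfrac_eq => /=; ring.
Qed.
Fact loc_mulC : commutative loc_mul.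
Proof.
elim/qfrac_ind=> x; elim/qfrac_ind=> y.
by rewrite !qfrac_mul; apply: qfrac_eq => /=; ring.
Qed.
Fact loc_mul1 : left_id loc_one loc_mul.
Proof. by elim/qfrac_ind=> x; rewrite qfrac_mul; apply: qfrac_eq => /=; ring. Qed.
Fact loc_mulDl : left_distributive loc_mul loc_add.
Proof.
elim/qfrac_ind=> x; elim/qfrac_ind=> y; elim/qfrac_ind=> z.
by rewrite !(qfrac_add, qfrac_mul); apply: qfrac_eq => /=; ring.
Qed.

HB.instance Definition _ :=
  GRing.isZmodule.Build loc loc_addA loc_addC loc_add0 loc_addN.
HB.instance Definition _ :=
  GRing.Zmodule_isComPzRing.Build loc loc_mulA loc_mulC loc_mul1 loc_mulDl.

(* The fraction a / g; only meaningful when g is in the multiplicative set. *)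
Definition frac (a g : A) : loc :=
  qfrac (a, insubd (exist _ 1 (asboolT (den_1 L)) : {g | `[< den L g >]}) g).

Lemma frac_mkfrac a g (dg : den L g) : frac a g = qfrac (mkfrac a dg).
Proof. by apply: qfrac_eq; rewrite /= val_insubd asboolT. Qed.

Lemma fracE a g b h : den L g -> den L h ->
  frac a g = frac b h <-> exists2 u, den L u & ker L (u * (a * h - b * g)).
Proof. by move=> dg dh; rewrite !frac_mkfrac qfracP. Qed.

Lemma fracB a g b h : den L g -> den L h ->
  frac a g - frac b h = frac (a * h - b * g) (g * h).
Proof.
move=> dg dh; rewrite !frac_mkfrac; first exact: den_M.
move=> dgh; rewrite -[LHS]/(loc_add _ (loc_opp _)) qfrac_opp qfrac_add.
by apply: qfrac_eq => /=; ring.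
Qed.

Lemma fracM a g b h : den L g -> den L h ->
  frac a g * frac b h = frac (a * b) (g * h).
Proof.
move=> dg dh; rewrite !frac_mkfrac; first exact: den_M.
move=> dgh; rewrite -[LHS]/(loc_mul _ _) qfrac_mul.
by apply: qfrac_eq => /=; ring.
Qed.

Lemma frac1 : frac 1 1 = 1.
Proof. by rewrite (frac_mkfrac _ (den_1 L)). Qed.

End Localization.

Definition bform (n : nat) : Type := {ffun 'I_n.+1 -> int}.
HB.instance Definition _ n := GRing.Zmodule.on (bform n).

Definition cf n (f : bform n) (i : nat) : int := f (inord i).

Local Notation ZXY := {mpoly int[2]}.
Definition vX : ZXY := 'X_(0 : 'I_2).
Definition vY : ZXY := 'X_(1 : 'I_2).

Definition form_poly n (f : bform n) : ZXY :=
  \sum_(i < n.+1) cf f i *: (vX ^+ (n - i) * vY ^+ i).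

Definition lin_subst (M : 'M[int]_2) (F : ZXY) : ZXY :=
  F \mPo [tuple M i 0 *: vX + M i 1 *: vY | i < 2].

Definition GL2_transform n (f f' : bform n) : Prop :=
  exists2 M : 'M[int]_2, M \in unitmx & form_poly f' = lin_subst M (form_poly f).

(* The forms f' whose R_f', I_f' and I_f'^# serve as R_f, I_f and I_f^#: f itself
   if f_0 != 0, otherwise any GL_2(Z)-transform of f with nonzero x^n-coefficient. *)
Definition model_form n (f f' : bform n) : Prop :=
  if cf f 0 != 0 then f' = f else GL2_transform f f' /\ cf f' 0 != 0.

Lemma model_form_exists n (f : bform n) : f != 0 -> exists f', model_form f f'.
Proof.
move=> fN0; have [f0|f0] := boolP (cf f 0 != 0).
  by exists f; rewrite /model_form f0.
pose P : {poly int} := \poly_(i < n.+1) cf f i.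
have PN0 : P != 0.
  apply: contraNneq fN0 => P0; apply/eqP/ffunP=> i; rewrite ffunE.
  have := congr1 (fun Q : {poly int} => Q`_i) P0.
  by rewrite coef_poly ltn_ord coef0 /cf inord_val.
have [m Pm] : exists m : int, P.[m] != 0.
  apply/not_existsP => Pr; case/negP: PN0; apply/eqP.
  pose r := [seq k%:Z | k <- iota 0 (size P)].
  apply: (@roots_geq_poly_eq0 _ P r).
  - by apply/allP => z _; rewrite /root; apply/negP => H; apply: (Pr z); apply/negP.
  - by rewrite map_inj_uniq ?iota_uniq // => x y [].
  - by rewrite size_map size_iota.
pose f' : bform n := [ffun j : 'I_n.+1 =>
  \sum_(i < n.+1) cf f i * (m ^+ (i - j) *+ 'C(i, j))].
exists f'; rewrite /model_form (negbTE f0); split; last first.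
  rewrite /cf ffunE inordK //; apply: contraNneq Pm => <-.
  rewrite horner_poly; apply/eqP/eq_bigr => i _.
  by rewrite subn0 bin0 mulr1n.
pose M : 'M[int]_2 := \matrix_(i, j) if (i == 0) && (j == 1) then 0 else
   if (i == 1) && (j == 0) then m else 1.
exists M.
  by rewrite unitmxE (expand_det_row _ 0) !big_ord_recl big_ord0 /cofactor
     !det_mx11 !mxE /= mul0r !addr0 !mul1r.
rewrite /lin_subst /form_poly rmorph_sum /=.
under [RHS]eq_bigr => i _.
  rewrite comp_mpolyZ rmorphM !rmorphXn /= !comp_mpolyXU.
  rewrite -!tnth_nth !tnth_mktuple !mxE /= scale0r addr0 !scale1r.
  rewrite exprDn mulr_sumr scaler_sumr.
  over.
transitivity (\sum_(i < n.+1) \sum_(j < n.+1)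
    (cf f i * (m ^+ (i - j) *+ 'C(i, j))) *: (vX ^+ (n - j) * vY ^+ j)).
  rewrite exchange_big; apply: eq_bigr => j _.
  by rewrite {1}/cf ffunE inord_val scaler_suml.
apply: eq_bigr => i _; rewrite [RHS](big_ord_widen n.+1 (fun j => cf f i *:
  (vX ^+ (n - i) * ((m *: vX) ^+ (i - j) * vY ^+ j *+ 'C(i, j))))) ?ltnS ?leq_ord //.
rewrite [RHS]big_mkcond; apply: eq_bigr => j _; rewrite ltnS.
case: leqP => [ji|ij]; last by rewrite bin_small // mulr0 scale0r.
have -> : (n - j = (n - i) + (i - j))%N by have := leq_ord i; lia.
rewrite exprZn exprD.
move: (vX ^+ (n - i)) (vX ^+ (i - j)) (vY ^+ j) (m ^+ (i - j)) => x x' y d.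
by rewrite -[X in _ = _ *: (_ * (X *+ _))]scalerAl scalerMnl -scalerAr scalerA -mulrA.
Qed.

(* A point of S_f: a homogeneous prime ideal of Z[x, y] that contains f but not
   the irrelevant ideal (x, y). *)
Record point n (f : bform n) := Point {
  pt :> ZXY -> Prop;
  pt_0 : pt 0;
  pt_D : forall a b, pt a -> pt b -> pt (a + b);
  pt_M : forall a b, pt b -> pt (a * b);
  pt_1 : ~ pt 1;
  pt_prime : forall a b, pt (a * b) -> pt a \/ pt b;
  pt_homog : forall a d, pt a -> pt (pihomog mdeg d a);
  pt_irrelevant : ~ (pt vX /\ pt vY);
  pt_form : pt (form_poly f) }.

Definition is_homog (a : ZXY) : Prop := exists d : nat, a \is d.-homog.

Section Stalk.
Variables (n : nat) (f : bform n) (p : point f).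

Let J (a : ZXY) : Prop := exists c, a = c * form_poly f.
Let T (g : ZXY) : Prop := is_homog g /\ ~ p g.

Fact stalk_ker_0 : J 0.
Proof. by exists 0; rewrite mul0r. Qed.
Fact stalk_ker_D x y : J x -> J y -> J (x + y).
Proof. by move=> [c ->] [d ->]; exists (c + d); rewrite mulrDl. Qed.
Fact stalk_ker_M a x : J x -> J (a * x).
Proof. by move=> [c ->]; exists (a * c); rewrite mulrA. Qed.
Fact stalk_den_1 : T 1.
Proof. by split; [exists 0%N; apply: dhomog1 | apply: pt_1]. Qed.
Fact stalk_den_M x y : T x -> T y -> T (x * y).
Proof.
move=> [[d xd] px] [[e ye] py]; split; first by exists (d + e)%N; apply: dhomogM.
by move=> /pt_prime[].
Qed.

(* T^-1 (Z[x, y] / (f)), for T the homogeneous elements outside p.  Its part of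
   degree k is the stalk at p of O_(S_f)(k), the quotient of the stalk
   Z[x, y](k)_(p) of O(k) by that of f O(k - n). *)
Definition stalk_datum : locdatum ZXY :=
  LocDatum stalk_ker_0 stalk_ker_D stalk_ker_M stalk_den_1 stalk_den_M.

End Stalk.

Section Sections.
Variables (n : nat) (f : bform n).

Definition stalks : Type := ringprod (fun p : point f => loc (stalk_datum p)).
HB.instance Definition _ := GRing.ComPzRing.on stalks.

(* Global sections of O_(S_f)(k): families of germs that, on a neighbourhood
   D(h) of each point, are given by a single fraction a / g of degree k. *)
Definition is_section (k : int) (s : stalks) : Prop :=
  forall p : point f, exists (d e : nat) (a g h : ZXY),
    [/\ a \is d.-homog, g \is e.-homog & d%:Z = e%:Z + k] /\
    [/\ is_homog h, ~ p h &
        forall q : point f, ~ q h -> ~ q g /\ s q = frac (stalk_datum q) a g].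

Lemma denI (q : point f) d (g : ZXY) : g \is d.-homog -> ~ q g -> den (stalk_datum q) g.
Proof. by move=> gd qg; split=> //; exists d. Qed.

Lemma section_1 : is_section 0 1.
Proof.
move=> p; exists 0%N, 0%N, 1, 1, 1; split; first by split=> //; apply: dhomog1.
split; [by exists 0%N; apply: dhomog1 | exact: pt_1 |].
by move=> q _; split; [apply: pt_1 | rewrite frac1].
Qed.

Lemma section_0 k : is_section k 0.
Proof.
move=> p.
have [v [v1 pv]] : exists v : ZXY, v \is 1.-homog /\ ~ p v.
  have [pX|pX] := pselect (p vX).
    have [pY|pY] := pselect (p vY); first by case: (pt_irrelevant (conj pX pY)).
    by exists vY; split=> //; rewrite dhomogX /= mdeg1.
  by exists vX; split=> //; rewrite dhomogX /= mdeg1.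
have pX (q : point f) m : ~ q v -> ~ q (v ^+ m).
  move=> qv; elim: m => [|m IHm]; first by rewrite expr0; apply: pt_1.
  by rewrite exprS => /pt_prime[].
have vm m : v ^+ m \is m.-homog.
  by have := dhomogMn m v1; rewrite mul1n.
exists (absz (k + (absz k)%:Z)), (absz k), 0, (v ^+ absz k), v; split; first split=> //.
- exact: rpred0.
- by case: (k) => m //=; rewrite NegzE addNr /= subrr.
split=> //; first by exists 1%N.
move=> q qv; split; first exact: pX.
have dm : den (stalk_datum q) (v ^+ absz k) by apply: (denI (vm _)); apply: pX.
rewrite -[LHS]/(0 : loc _) -(subrr (frac (stalk_datum q) 0 (v ^+ absz k))) fracB //.
rewrite !mul0r subrr (fracE _ _ (den_M dm dm) dm).
by exists 1; [apply: den_1 | rewrite !mul0r subrr mulr0; apply: ker_0].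
Qed.

Lemma section_B k s t : is_section k s -> is_section k t -> is_section k (s - t).
Proof.
move=> hs ht p.
have [d [e [a [g [h [[ad ge dek] [[i hi] ph H]]]]]]] := hs p.
have [d' [e' [a' [g' [h' [[ad' ge' dek'] [[i' hi'] ph' H']]]]]]] := ht p.
exists (d + e')%N, (e + e')%N, (a * g' - a' * g), (g * g'), (h * h').
have E : (d + e' = d' + e)%N.
  by apply/eqP; rewrite -eqz_nat !PoszD dek dek'; apply/eqP; ring.
split; first split.
- by apply: rpredB; [|rewrite E]; apply: dhomogM.
- exact: dhomogM.
- by rewrite !PoszD dek; ring.
split; first by exists (i + i')%N; apply: dhomogM.
  by move=> /pt_prime[].
move=> q qhh.
have qh : ~ q h by move=> ?; apply: qhh; rewrite mulrC; apply: pt_M.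
have qh' : ~ q h' by move=> ?; apply: qhh; apply: pt_M.
have [qg sq] := H q qh; have [qg' tq] := H' q qh'.
split; first by move=> /pt_prime[].
rewrite -[LHS]/(s q - t q) sq tq fracB //; first exact: denI ge qg.
exact: denI ge' qg'.
Qed.

Lemma section_M k l s t :
  is_section k s -> is_section l t -> is_section (k + l) (s * t).
Proof.
move=> hs ht p.
have [d [e [a [g [h [[ad ge dek] [[i hi] ph H]]]]]]] := hs p.
have [d' [e' [a' [g' [h' [[ad' ge' dek'] [[i' hi'] ph' H']]]]]]] := ht p.
exists (d + d')%N, (e + e')%N, (a * a'), (g * g'), (h * h').
split; first split.
- exact: dhomogM.
- exact: dhomogM.
- by rewrite !PoszD dek dek'; ring.
split; first by exists (i + i')%N; apply: dhomogM.
  by move=> /pt_prime[].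
move=> q qhh.
have qh : ~ q h by move=> ?; apply: qhh; rewrite mulrC; apply: pt_M.
have qh' : ~ q h' by move=> ?; apply: qhh; apply: pt_M.
have [qg sq] := H q qh; have [qg' tq] := H' q qh'.
split; first by move=> /pt_prime[].
rewrite -[LHS]/(s q * t q) sq tq fracM //; first exact: denI ge qg.
exact: denI ge' qg'.
Qed.

Lemma section_M0 s t : is_section 0 s -> is_section 0 t -> is_section 0 (s * t).
Proof. by move=> hs ht; rewrite -[0]addr0; apply: section_M. Qed.

Definition GammaO : subring stalks := Subring section_1 (@section_B 0) section_M0.

Lemma section_Z k r s : GammaO r -> is_section k s -> is_section k (r * s).
Proof. by move=> hr hs; rewrite -[k]add0r; apply: section_M. Qed.

Definition GammaOk (k : int) : submod GammaO :=
  Submod (section_0 k) (@section_B k) (@section_Z k).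

End Sections.

(* {poly %/ h} is the quotient by h only for h monic of positive degree, hence
   the normalisation; it makes Q_f the expected ring when f_0 != 0 and n > 0. *)
Definition dehom n (f : bform n) : {poly rat} := \poly_(i < n.+1) (cf f (n - i))%:~R.

Definition Qf n (f : bform n) : Type :=
  {poly %/ ((cf f 0)%:~R^-1 *: dehom f)}.
HB.instance Definition _ n (f : bform n) := GRing.ComNzRing.on (Qf f).

Definition theta n (f : bform n) : Qf f := in_qpoly _ 'X.

(* This is \zeta_k for k >= 1 only: \zeta_0 = 1, whereas zeta f 0 is 0. *)
Definition zeta n (f : bform n) (k : nat) : Qf f :=
  \sum_(j < k) theta f ^+ (k - j) *~ cf f j.

Definition xi n (f : bform n) (k : nat) : Qf f :=
  \sum_(j < k.+1) theta f ^+ (k - j) *~ cf f j.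

Section Rf.
Variables (n : nat) (f : bform n).

Lemma Qf_modulus : (0 < n)%N -> cf f 0 != 0 ->
  mk_monic ((cf f 0)%:~R^-1 *: dehom f) = (cf f 0)%:~R^-1 *: dehom f.
Proof.
move=> n0 f0; have f0Q : (cf f 0)%:~R != 0 :> rat by rewrite intr_eq0.
have sd : size (dehom f) = n.+1 by rewrite size_poly_eq // subnn.
rewrite /mk_monic size_scale ?invr_eq0 // sd ltnS n0 monicE lead_coefZ.
by rewrite lead_coefE sd coef_poly ltnSn subnn mulVf // eqxx.
Qed.

Definition Rf_set (x : Qf f) : Prop :=
  exists a : nat -> int,
    x = (a 0%N)%:~R + \sum_(1 <= k < n) zeta f k *~ a k.

Definition Ifsharp_set (x : Qf f) : Prop :=
  exists a : nat -> int, x = \sum_(0 <= k < n) xi f k *~ a k.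

Lemma zetaE k : zeta f k.+1 = theta f * xi f k.
Proof.
rewrite /zeta /xi mulr_sumr; apply: eq_bigr => j _.
by rewrite (subSn (leq_ord j)) exprS mulrzAr.
Qed.

Lemma zeta0 : zeta f 0 = 0. Proof. by rewrite /zeta big_ord0. Qed.

Lemma xiE k : xi f k = zeta f k + (cf f k)%:~R.
Proof. by rewrite /xi big_ord_recr /= subnn. Qed.

(* Either f(theta, 1) = 0, or we are in the degenerate case theta = 0 where the
   quotient defining Q_f is not the intended one. *)
Lemma xin_or : xi f n = 0 \/ theta f = 0.
Proof.
set h := (cf f 0)%:~R^-1 *: dehom f.
have [/andP[h1 hm]|hN] := boolP ((1 < size h)%N && (h \is monic)); last first.
  right; apply: val_inj; rewrite /= /mk_monic -/h (negbTE hN).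
  exact: Pdiv.RingMonic.rmodpp (monicX _).
left; have f0 : (cf f 0)%:~R != 0 :> rat.
  apply: contraTneq h1 => f0; rewrite /h f0 invr0 scale0r size_poly0.
  by [].
have -> : xi f n = in_qpoly h (dehom f).
  rewrite /dehom poly_def [RHS]raddf_sum /xi (reindex_inj rev_ord_inj) /=.
  apply: eq_bigr => i _; rewrite subSS subKn ?leq_ord // in_qpolyZ /theta.
  by rewrite rmorphXn /= scaler_int.
have -> : dehom f = (cf f 0)%:~R *: h by rewrite /h scalerA divff ?scale1r.
rewrite in_qpolyZ; suff -> : in_qpoly h h = 0 by rewrite scaler0.
apply: val_inj; rewrite /= /mk_monic h1 hm /=.
exact: Pdiv.RingMonic.rmodpp hm.
Qed.

Lemma xi_rel i j :
  zeta f i.+1 * xi f j = zeta f i * xi f j.+1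
    + xi f j.+1 *~ cf f i - xi f i *~ cf f j.+1.
Proof.
have -> : zeta f i.+1 * xi f j = xi f i * zeta f j.+1 by rewrite !zetaE; ring.
have -> : zeta f j.+1 = xi f j.+1 - (cf f j.+1)%:~R by rewrite (xiE j.+1) addrK.
by rewrite mulrBr (xiE i) mulrDl mulrzl mulrzr.
Qed.

Lemma zeta_theta0 k : theta f = 0 -> zeta f k = 0.
Proof. by case: k => [|k] t0; rewrite ?zeta0 // zetaE t0 mul0r. Qed.

Lemma zetaM i j : zeta f i.+1 * zeta f j = zeta f i * zeta f j.+1
    + zeta f j.+1 *~ cf f i - zeta f i.+1 *~ cf f j.
Proof.
have -> : zeta f j = xi f j - (cf f j)%:~R by rewrite xiE addrK.
rewrite mulrBr mulrzr; congr (_ - _).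
have -> : zeta f i.+1 * xi f j = xi f i * zeta f j.+1 by rewrite !zetaE; ring.
by rewrite xiE mulrDl mulrzl.
Qed.

Lemma Rf_B x y : Rf_set x -> Rf_set y -> Rf_set (x - y).
Proof.
move=> [a ->] [b ->]; exists (fun k => a k - b k).
rewrite mulrzBr opprD addrACA -sumrB; congr (_ + _).
by apply: eq_bigr => k _; rewrite mulrzBr.
Qed.

Lemma Rf_int m : Rf_set m%:~R.
Proof.
exists (fun k => if k is 0 then m else 0) => /=.
by rewrite big_nat_cond big1 ?addr0 // => -[|k].
Qed.

Lemma Rf_1 : Rf_set 1. Proof. exact: (Rf_int 1). Qed.

Lemma Rf_0 : Rf_set 0. Proof. exact: (Rf_int 0). Qed.

Lemma Rf_D x y : Rf_set x -> Rf_set y -> Rf_set (x + y).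
Proof.
move=> Rx Ry; rewrite -[y]opprK; apply: Rf_B => //.
by rewrite -sub0r; apply: Rf_B => //; apply: Rf_0.
Qed.

Lemma Rf_sum m m' (F : nat -> Qf f) :
  (forall k, (m <= k < m')%N -> Rf_set (F k)) -> Rf_set (\sum_(m <= k < m') F k).
Proof.
move=> RF; rewrite big_nat_cond; elim/big_ind: _ => [|x y|k].
- exact: Rf_0.
- exact: Rf_D.
- by rewrite andbT => /RF.
Qed.

Lemma Rf_z x m : Rf_set x -> Rf_set (x *~ m).
Proof.
move=> [a ->]; exists (fun k => a k * m); rewrite mulrzDl -mulrzA.
by congr (_ + _); rewrite mulrz_suml; apply: eq_bigr => k _; rewrite mulrzA.
Qed.

Lemma Rf_zeta k : (k <= n)%N -> Rf_set (zeta f k).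
Proof.
have [k0|k0] := posnP k; first by rewrite k0 zeta0; move=> _; apply: Rf_0.
rewrite leq_eqVlt => /predU1P[kn|kn].
  have [x0|t0] := xin_or; last by rewrite zeta_theta0 //; apply: Rf_0.
  have -> : zeta f k = (- cf f n)%:~R.
    by apply: (addIr (cf f k)%:~R); rewrite -xiE kn x0 mulrNz addNr.
  exact: Rf_int.
exists (fun j => (j == k)%:R); rewrite eq_sym (gtn_eqF k0) add0r.
rewrite (bigD1_seq k) ?mem_index_iota ?k0 ?iota_uniq //= eqxx mulr1z.
by rewrite big1 ?addr0 // => j /negbTE ->.
Qed.

Lemma Rf_zetaM i j : (i <= n)%N -> (j <= n)%N -> Rf_set (zeta f i * zeta f j).
Proof.
elim: i j => [|i IHi] j ii ji; first by rewrite zeta0 mul0r; apply: Rf_0.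
move: ji; rewrite leq_eqVlt => /predU1P[jn|jn].
  have [x0|t0] := xin_or; last by rewrite (zeta_theta0 j t0) mulr0; apply: Rf_0.
  have -> : zeta f j = (- cf f n)%:~R.
    by apply: (addIr (cf f j)%:~R); rewrite -xiE jn x0 mulrNz addNr.
  by rewrite mulrzr; apply/Rf_z/Rf_zeta.
rewrite zetaM; apply: Rf_B; first apply: Rf_D.
- by apply: IHi => //; apply: ltnW.
- by apply/Rf_z/Rf_zeta.
- by apply/Rf_z/Rf_zeta.
Qed.

Lemma Rf_M x y : Rf_set x -> Rf_set y -> Rf_set (x * y).
Proof.
move=> [a ->] Ry; rewrite mulrDl; apply: Rf_D.
  by rewrite mulrzl; apply: Rf_z.
rewrite mulr_suml; apply: Rf_sum => i /andP[_ /ltnW lin].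
rewrite mulrzAl; apply: Rf_z; case: Ry => [b ->]; rewrite mulrDr; apply: Rf_D.
  by rewrite mulrzr; apply/Rf_z/Rf_zeta.
rewrite mulr_sumr; apply: Rf_sum => j /andP[_ /ltnW ljn].
by rewrite mulrzAr; apply/Rf_z/Rf_zetaM.
Qed.

Definition Rf : subring (Qf f) := Subring Rf_1 Rf_B Rf_M.

Definition If_set (x : Qf f) : Prop :=
  exists a b : Qf f, [/\ Rf a, Rf b & x = a + b * theta f].

Lemma If_0 : If_set 0.
Proof. by exists 0, 0; split; [apply: Rf_0 .. | rewrite mul0r addr0]. Qed.
Lemma If_B x y : If_set x -> If_set y -> If_set (x - y).
Proof.
move=> [a [b [Ra Rb ->]]] [c [d [Rc Rd ->]]]; exists (a - c), (b - d).
by split; [apply: Rf_B .. | ring].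
Qed.
Lemma If_Z r x : Rf r -> If_set x -> If_set (r * x).
Proof.
move=> Rr [a [b [Ra Rb ->]]]; exists (r * a), (r * b).
by split; [apply: Rf_M .. | ring].
Qed.

Definition If : submod Rf := Submod If_0 If_B If_Z.

Lemma Ifs_B x y : Ifsharp_set x -> Ifsharp_set y -> Ifsharp_set (x - y).
Proof.
move=> [a ->] [b ->]; exists (fun k => a k - b k).
by rewrite -sumrB; apply: eq_bigr => k _; rewrite mulrzBr.
Qed.

Lemma Ifs_0 : Ifsharp_set 0.
Proof. by exists (fun=> 0); rewrite big1. Qed.

Lemma Ifs_D x y : Ifsharp_set x -> Ifsharp_set y -> Ifsharp_set (x + y).
Proof.
move=> Ix Iy; rewrite -[y]opprK; apply: Ifs_B => //.
by rewrite -sub0r; apply: Ifs_B => //; apply: Ifs_0.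
Qed.

Lemma Ifs_sum m m' (F : nat -> Qf f) :
  (forall k, (m <= k < m')%N -> Ifsharp_set (F k)) ->
  Ifsharp_set (\sum_(m <= k < m') F k).
Proof.
move=> RF; rewrite big_nat_cond; elim/big_ind: _ => [|x y|k].
- exact: Ifs_0.
- exact: Ifs_D.
- by rewrite andbT => /RF.
Qed.

Lemma Ifs_z x m : Ifsharp_set x -> Ifsharp_set (x *~ m).
Proof.
move=> [a ->]; exists (fun k => a k * m).
by rewrite mulrz_suml; apply: eq_bigr => k _; rewrite mulrzA.
Qed.

Lemma Ifs_xi k : xi f n = 0 -> (k <= n)%N -> Ifsharp_set (xi f k).
Proof.
move=> x0; rewrite leq_eqVlt => /predU1P[->|kn]; first by rewrite x0; apply: Ifs_0.
exists (fun j => (j == k)%:R).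
rewrite (bigD1_seq k) ?mem_index_iota ?iota_uniq //= eqxx mulr1z.
by rewrite big1 ?addr0 // => j /negbTE ->.
Qed.

Lemma Ifs_zetaxi i j : xi f n = 0 -> (i <= n)%N -> (j <= n)%N ->
  Ifsharp_set (zeta f i * xi f j).
Proof.
move=> x0; elim: i j => [|i IHi] j ii; first by rewrite zeta0 mul0r => _; apply: Ifs_0.
rewrite leq_eqVlt => /predU1P[->|jn]; first by rewrite x0 mulr0; apply: Ifs_0.
rewrite xi_rel; apply: Ifs_B; first apply: Ifs_D.
- by apply: IHi => //; apply: ltnW.
- by apply/Ifs_z/Ifs_xi.
- by apply/Ifs_z/Ifs_xi => //; apply: ltnW.
Qed.

Lemma Ifs_Z r x : Rf r -> Ifsharp_set x -> Ifsharp_set (r * x).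
Proof.
move=> [a ->] Ix; rewrite mulrDl; apply: Ifs_D.
  by rewrite mulrzl; apply: Ifs_z.
rewrite mulr_suml; apply: Ifs_sum => i /andP[_ /ltnW lin].
rewrite mulrzAl; apply: Ifs_z.
have [x0|t0] := xin_or; last by rewrite (zeta_theta0 i t0) mul0r; apply: Ifs_0.
case: Ix => [b ->]; rewrite mulr_sumr; apply: Ifs_sum => j /andP[_ /ltnW ljn].
by rewrite mulrzAr; apply/Ifs_z/Ifs_zetaxi.
Qed.

Definition Ifsharp : submod Rf := Submod Ifs_0 Ifs_B Ifs_Z.

End Rf.

(* Main.v *)
Require Import Defs.
From HB Require Import structures.
From mathcomp Require Import all_boot all_order all_algebra.
From mathcomp Require Import boolp mpoly zify ring.
From mathcomp Require classical_sets.

(* A form with nonzero leading coefficient has the class of Y as a nonzerodivisor,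
   so a section of O(k) is determined by its restriction to D(Y), which is
   Y^k P(X/Y) for an integral polynomial P modulo G = g(t, 1).  Such a P comes from
   a global section iff it extends over D(X), i.e. t^N P = Q + H G with
   deg Q <= N + k.  Cutting H at degree N writes P modulo G as an integral
   combination of 1, ..., t^k and of the truncations xi_m = g_0 t^m + ... + g_m
   with k < m < n; these span I_f^k (R_f for k = 0, I_f^# for k = -1). *)

Set Implicit Arguments.
Unset Strict Implicit.
Unset Printing Implicit Defensive.

Import GRing.Theory.
Local Open Scope ring_scope.

(** The shape of the spanning family comes from 0 -> O(k - n) -> O(k) -> O_(S_f)(k) -> 0 on P^1: the
    powers 1, ..., t^k are H^0(O(k)), and the truncations lift H^1(O(k - n)), of rank n - k - 1. The
    sequence of global sections is short because H^1(O(k)) = 0 for k >= -1 and H^0(O(k - n)) = 0 for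
    k < n, which is the range of the theorem. It is encoded by the natural number [K] = k + 1 with
    [K <= n], so that k = -1 becomes [K] = 0. The obstacle to passing to Q_f is content: if the
    coefficients of the form have a common factor, Z[t]/(G) has torsion and does not embed in Q_f,
    so restriction to D(Y) followed by t = theta need not be injective. The gluing condition with
    [K <= n] excludes this torsion for global sections ([gluable_dvd]). *)

Local Notation ZXY := {mpoly int[2]}.

(** * Homogeneous primes and quasi-compactness *)

Section PrimeAvoidance.
Variable A : comNzRingType.
Implicit Types J P : A -> Prop.

Definition ideal J : Prop :=
  [/\ J 0, forall x y, J x -> J y -> J (x + y) & forall a x, J x -> J (a * x)].

Lemma ideal_sum J (I : Type) (r : seq I) (Q : pred I) (F : I -> A) :
  ideal J -> (forall i, Q i -> J (F i)) -> J (\sum_(i <- r | Q i) F i).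
Proof. by move=> [J0 JD _] JF; elim/big_ind: _. Qed.

(** Krull's argument: an ideal that is maximal among those containing [J] and missing the powers of
    [v] is prime. *)
Lemma prime_avoid J v : ideal J -> (forall m, ~ J (v ^+ m)) ->
  exists P, [/\ ideal P, forall x, J x -> P x,
                forall a b, P (a * b) -> P a \/ P b & ~ P v].
Proof.
move=> idJ Jv.
(* The empty set is allowed because Zorn_bigcup also tests the empty chain. *)
pose good P := (forall x, ~ P x) \/
  [/\ ideal P, forall x, J x -> P x & forall m, ~ P (v ^+ m)].
have [F FP Ftot|P [goodP maxP]] := @classical_sets.Zorn_bigcup A good.
  have [[X FX [x Xx]]|noX] := pselect (exists2 X, F X & exists x, X x); last first.
    by left=> x [X FX Xx]; apply: noX; exists X => //; exists x.
  right; have ne Y y : F Y -> Y y ->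
      [/\ ideal Y, forall x, J x -> Y x & forall m, ~ Y (v ^+ m)].
    by move=> FY Yy; have [/(_ y)|] := FP _ FY.
  have [[X0 XD XM] JX Xv] := ne _ _ FX Xx.
  split; last by move=> m [Y FY Yv]; have [_ _ /(_ m)] := ne _ _ FY Yv.
    split; first by exists X.
      move=> y z [Y FY Yy] [Z FZ Zz].
      have [[_ YD _] _ _] := ne _ _ FY Yy; have [[_ ZD _] _ _] := ne _ _ FZ Zz.
      have [YZ|ZY] := Ftot _ _ FY FZ.
        by exists Z => //; apply: ZD => //; apply: YZ.
      by exists Y => //; apply: YD => //; apply: ZY.
    move=> a y [Y FY Yy]; have [[_ _ YM] _ _] := ne _ _ FY Yy.
    by exists Y => //; apply: YM.
  by move=> y Jy; exists X => //; apply: JX.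
(* The empty set is not maximal, since [J] is larger. *)
have [[P0 PD PM] JP Pv] : [/\ ideal P, forall x, J x -> P x & forall m, ~ P (v ^+ m)].
  case: goodP => [Pe|//]; case: (maxP J); last by right.
  have [J0 _ _] := idJ.
  by split=> [x Px|JP]; [case: (Pe x) | case: (Pe 0); apply: JP].
exists P; split=> //; last by move=> Pv1; apply: (Pv 1%N); rewrite expr1.
(* By maximality, the ideal P + (a) contains a power of [v]. *)
have extP a : ~ P a -> exists m c p, P p /\ v ^+ m = p + c * a.
  move=> Pa; apply: contrapT => nov.
  pose B x := exists c p, P p /\ x = p + c * a.
  have PB x : P x -> B x by move=> Px; exists 0, x; rewrite mul0r addr0.
  apply: (maxP B).
    split=> // BP; apply/Pa/BP; exists 1, 0; split=> //; ring.
  right; split; last 1 first.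
  - by move=> m [c [p [Pp E]]]; apply: nov; exists m, c, p.
  - split; first exact: PB.
      move=> x y [c [p [Pp ->]]] [d [q [Pq ->]]].
      by exists (c + d), (p + q); split; [apply: PD | ring].
    move=> b x [c [p [Pp ->]]].
    by exists (b * c), (b * p); split; [apply: PM | ring].
  - by move=> x /JP/PB.
move=> a b Pab; apply: contrapT => /not_orP[Pa Pb].
have [m [c [p [Pp Em]]]] := extP a Pa; have [l [d [q [Pq El]]]] := extP b Pb.
apply: (Pv (m + l)%N); rewrite exprD Em El.
have -> : (p + c * a) * (q + d * b) = (q + d * b) * p + ((c * a) * q + c * d * (a * b)).
  by ring.
by apply: (PD); [|apply: (PD)]; apply: PM.
Qed.

End PrimeAvoidance.

Section HomogeneousPart.
Local Notation comp d := (@pihomog 2 int mdeg d).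

Lemma comp_homogM (a b : ZXY) d e : a \is e.-homog ->
  comp d (a * b) = if (e <= d)%N then a * comp (d - e) b else 0.
Proof.
move=> ae; rewrite {1}(@pihomog_partitionE _ _ mdeg (msize b + d.+1) b); last first.
  exact: leq_trans (leq_addr _ _).
rewrite mulr_sumr raddf_sum /=.
have aei i : a * comp i b \is (e + i).-homog.
  by apply: dhomogM => //; apply: pihomogP.
case: leqP => [ed|de]; last first.
  rewrite big1 // => i _; rewrite (pihomog_ne0 _ (aei i)) //; lia.
have lt : (d - e < msize b + d.+1)%N by lia.
rewrite (bigD1 (Ordinal lt)) //= big1 ?addr0.
  by rewrite pihomog_dE //; have := aei (d - e)%N; rewrite subnKC.
move=> i ine; apply: (pihomog_ne0 _ (aei i)).
by apply: contra ine => /eqP E; apply/eqP/val_inj => /=; lia.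
Qed.

Lemma compM (a b : ZXY) d :
  comp d (a * b) = \sum_(l < d.+1) comp l a * comp (d - l) b.
Proof.
rewrite {1}(@pihomog_partitionE _ _ mdeg (msize a + d.+1) a) ?leq_addr //.
rewrite mulr_suml raddf_sum /= addnC big_split_ord /= [X in _ + X]big1 => [|i _].
  rewrite addr0; apply: eq_bigr => i _; rewrite (@comp_homogM _ _ _ i) ?pihomogP //.
  by rewrite (leq_ord i).
rewrite (@comp_homogM _ _ _ (d.+1 + i)) ?pihomogP //.
by rewrite leqNgt ltn_addr.
Qed.

(* The largest homogeneous ideal inside P, usually written P^*. *)
Definition hpart (P : ZXY -> Prop) (a : ZXY) : Prop := forall d, P (comp d a).

Lemma hpart_homog P a d : ideal P -> a \is d.-homog -> hpart P a <-> P a.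
Proof.
move=> [P0 _ _] ad; split=> [/(_ d)|Pa e]; first by rewrite pihomog_dE.
have [<-|de] := eqVneq d e; first by rewrite pihomog_dE.
by rewrite (pihomog_ne0 de ad).
Qed.

Lemma hpart_ideal P : ideal P -> ideal (hpart P).
Proof.
move=> idP; have [P0 PD PM] := idP; split.
- by move=> d; rewrite raddf0.
- by move=> x y Px Py d; rewrite raddfD; apply: PD; [apply: Px | apply: Py].
- by move=> a x Px d; rewrite compM; apply: ideal_sum => // i _; apply: PM; apply: Px.
Qed.

(** If the lowest components of [a] and [b] outside [P] have degrees i and j, then the component of
    [a * b] in degree i + j is their product plus terms in [P]. *)
Lemma hpart_prime P : ideal P -> (forall a b, P (a * b) -> P a \/ P b) ->
  forall a b, hpart P (a * b) -> hpart P a \/ hpart P b.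
Proof.
move=> idP pP a b Pab; have [P0 PD PM] := idP.
have low c : ~ hpart P c ->
    exists i, ~ P (comp i c) /\ forall j, (j < i)%N -> P (comp j c).
  move=> /existsNP nc; have ex : exists i, `[< ~ P (comp i c) >].
    by case: nc => i ?; exists i; apply/asboolP.
  case: (ex_minnP ex) => i /asboolP Pi mini; exists i; split=> // j ji.
  by apply: contrapT => /asboolP/mini; rewrite leqNgt ji.
apply: contrapT => /not_orP[/low[i [Pi lowi]] /low[j [Pj lowj]]].
case: (pP (comp i a) (comp j b)) => //.
have lt : (i < (i + j).+1)%N by lia.
have := Pab (i + j)%N; rewrite compM (bigD1 (Ordinal lt)) //= addKn.
set x := comp i a * comp j b; set y := (X in x + X) => Pxy.
have Py : P y.
  apply: ideal_sum => // l ne.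
  have [li|il] := ltnP l i; first by rewrite mulrC; apply/PM/lowi.
  apply/PM/lowj; have : nat_of_ord l != i.
    by apply: contra ne => /eqP E; apply/eqP/val_inj.
  by have := ltn_ord l; lia.
by rewrite -(addrK y x) -mulN1r; apply: PD => //; apply: PM.
Qed.

End HomogeneousPart.

Section Points.
Variables (n : nat) (f : bform n).

Lemma ptX (p : point f) v m : p (v ^+ m) -> p v.
Proof.
by elim: m => [|m IHm]; [rewrite expr0 => /pt_1 | rewrite exprS => /pt_prime[]].
Qed.

Lemma homog1X (v : ZXY) m : v \is 1.-homog -> v ^+ m \is m.-homog.
Proof. by move=> v1; have := dhomogMn m v1; rewrite mul1n. Qed.

Lemma form_poly_homog m (g : bform m) : form_poly g \is m.-homog.
Proof.
apply: rpred_sum => i _; apply: dhomogZ.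
have H : vX ^+ (m - i) * vY ^+ i \is (m - i + i).-homog.
  by apply: dhomogM; apply: homog1X; rewrite dhomogX /= mdeg1.
by move: H; rewrite subnK ?leq_ord.
Qed.

(** For such [v], a homogeneous prime avoiding [v] cannot contain (x, y), hence is a point of
    Proj. *)
Definition in_irrelevant (v : ZXY) : Prop := exists a b, v = a * vX + b * vY.

Lemma in_irrelevantMl a v : in_irrelevant v -> in_irrelevant (a * v).
Proof. by move=> [b [c ->]]; exists (a * b), (a * c); ring. Qed.

(* Quasi-compactness of D(v). *)
Lemma point_cover (J : ZXY -> Prop) (v : ZXY) :
  ideal J -> J (form_poly f) -> is_homog v -> in_irrelevant v ->
  (forall p : point f, ~ p v -> exists h, [/\ is_homog h, J h & ~ p h]) ->
  exists m, J (v ^+ m).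
Proof.
move=> idJ Jf [d vd] [x [y Ev]] cov; apply: contrapT => /forallNP Jv.
(* The homogeneous part of [P] is a point of S_f in D(v); the [h] supplied there lies in [J], hence
   in [P], a contradiction. *)
have [P [idP JP pP Pv]] := prime_avoid idJ Jv.
have [H0 HD HM] := hpart_ideal idP.
have Hv : ~ hpart P v by move/(hpart_homog idP vd).
have H1 : ~ hpart P 1 by move=> h; apply: Hv; rewrite -(mulr1 v); apply: HM.
have Hh a e : hpart P a -> hpart P (pihomog mdeg e a).
  by move=> Pa; apply/(hpart_homog idP (pihomogP _ _ _)).
have Hi : ~ (hpart P vX /\ hpart P vY).
  by move=> [hX hY]; apply: Hv; rewrite Ev; apply: HD; apply: HM.
have Hf : hpart P (form_poly f).
  by apply/(hpart_homog idP (form_poly_homog f))/JP.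
have [h [[e he] Jh []]] := cov (Point H0 HD HM H1 (hpart_prime idP pP) Hh Hi Hf) Hv.
by apply/(hpart_homog idP he)/JP.
Qed.

End Points.

(** * Germs and sections over D(v) *)

Section Germs.
Variables (n : nat) (f : bform n).
Local Notation F := (form_poly f).

Definition germ (q : point f) (a : ZXY) : loc (stalk_datum q) := Defs.frac _ a 1.

Lemma den1 q : den (stalk_datum (f := f) q) 1. Proof. exact: den_1. Qed.

Lemma germ_is_zmod_morphism q : zmod_morphism (germ q).
Proof. by move=> a b; rewrite /germ fracB ?mulr1 //; apply: den1. Qed.
Lemma germ_is_monoid_morphism q : monoid_morphism (germ q).
Proof.
by split=> [|a b]; rewrite /germ ?frac1 // fracM ?mulr1 //; apply: den1.
Qed.
HB.instance Definition _ q :=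
  GRing.isZmodMorphism.Build ZXY (loc (stalk_datum q)) (germ q)
    (germ_is_zmod_morphism q).
HB.instance Definition _ q :=
  GRing.isMonoidMorphism.Build ZXY (loc (stalk_datum q)) (germ q)
    (germ_is_monoid_morphism q).

Lemma germ_eq0 q a :
  germ q a = 0 <-> exists u c, [/\ is_homog u, ~ q u & u * a = c * F].
Proof.
rewrite -(rmorph0 (germ q)) /germ fracE; try exact: den1.
rewrite !mulr1 subr0; split=> [[u [hu qu] [c E]]|[u [c [hu qu E]]]].
  by exists u, c.
by exists u => //; exists c.
Qed.

Lemma germF q : germ q F = 0.
Proof.
apply/germ_eq0; exists 1, 1; split=> //; last exact: pt_1.
by exists 0%N; apply: dhomog1.
Qed.

(** A homogeneous [g] outside [q] becomes a unit in the stalk. *)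
Lemma germI q g (x y : loc (stalk_datum q)) : is_homog g -> ~ q g ->
  x * germ q g = y * germ q g -> x = y.
Proof.
move=> hg qg E; have dg : den (stalk_datum q) g by [].
have gV : germ q g * Defs.frac _ 1 g = 1.
  rewrite /germ fracM // ?mul1r ?mulr1; last exact: den1.
  rewrite -(frac1 (stalk_datum q)) fracE //; last exact: den1.
  by exists 1; [apply: den1 | rewrite !mul1r mulr1 subrr; apply: ker_0].
by rewrite -(mulr1 x) -(mulr1 y) -gV !mulrA E.
Qed.

(** Trades fractions for products of germs, so that later computations are ring identities. *)
Lemma fracP q a g (x : loc (stalk_datum q)) : is_homog g -> ~ q g ->
  x = Defs.frac _ a g <-> x * germ q g = germ q a.
Proof.
move=> hg qg; have dg : den (stalk_datum q) g by [].
have E : Defs.frac (stalk_datum q) a g * germ q g = germ q a.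
  rewrite /germ fracM // ?mulr1; last exact: den1.
  rewrite fracE //; last exact: den1.
  by exists 1; [apply: den1 | rewrite mulr1 subrr mulr0; apply: ker_0].
by split=> [->//|]; rewrite -E; apply: germI.
Qed.

(** Writing a / g as (a h) / (g h) lets the denominator itself cut out the neighbourhood. *)
Lemma sectionP k (s : stalks f) : is_section k s <->
  forall p : point f, exists d e a g,
    [/\ a \is d.-homog, g \is e.-homog & d%:Z = e%:Z + k] /\
    [/\ ~ p g & forall q : point f, ~ q g -> s q * germ q g = germ q a].
Proof.
split=> H p.
  have [d [e [a [g [h [[ad ge dek] [[i hi] ph loc]]]]]]] := H p.
  have [pg _] := loc p ph.
  exists (d + i)%N, (e + i)%N, (a * h), (g * h); split.
    by split; [apply: dhomogM | apply: dhomogM | rewrite !PoszD dek; ring].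
  split=> [/pt_prime[]//|q qgh].
  have qh : ~ q h by move=> ?; apply/qgh/pt_M.
  have [qg E] := loc q qh; have hg : is_homog g by exists e.
  by rewrite !rmorphM /= mulrA ((fracP _ _ hg qg).1 E).
have [d [e [a [g [[ad ge dek] [pg loc]]]]]] := H p.
have hg : is_homog g by exists e.
exists d, e, a, g, g; split=> //; split=> // q qg; split=> //.
by apply/(fracP _ _ hg qg)/loc.
Qed.

(** The multipliers sending [b] into (F) form an ideal not contained in any point of D(v); by
    quasi-compactness it contains a power of [v]. *)
Lemma germ_vanish v b : is_homog v -> in_irrelevant v ->
  (forall q : point f, ~ q v -> germ q b = 0) -> exists m c, v ^+ m * b = c * F.
Proof.
move=> hv iv b0; apply: (@point_cover _ f (fun u => exists c, u * b = c * F)) => //.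
- split; first by exists 0; rewrite !mul0r.
    by move=> x y [c Ec] [d Ed]; exists (c + d); rewrite !mulrDl Ec Ed.
  by move=> a x [c Ec]; exists (a * c); rewrite -!mulrA Ec.
- by exists b; rewrite mulrC.
- move=> p /b0/germ_eq0[u [c [hu pu E]]].
  by exists u; split=> //; exists c.
Qed.

Lemma is_homogM a b : is_homog a -> is_homog b -> is_homog (a * b).
Proof. by move=> [d ad] [e be]; exists (d + e)%N; apply: dhomogM. Qed.

Lemma is_homogX a m : is_homog a -> is_homog (a ^+ m).
Proof. by move=> [d ad]; exists (d * m)%N; apply: dhomogMn. Qed.

(** If s = a / g near [p], some power of [g] kills s g - a on all of D(v). Indeed, where s = a' /
    g', the element a' g - a g' vanishes on D(g g' v), so (g g' v)^L kills it modulo F;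
    quasi-compactness makes the exponent uniform. *)
Lemma section_near k (s : stalks f) v (p : point f) :
  is_section k s -> is_homog v -> in_irrelevant v -> ~ p v -> exists u b, [/\ is_homog u, ~ p u &
    forall q : point f, ~ q v -> s q * germ q u = germ q b].
Proof.
move=> /sectionP Hs hv iv pv.
have [d [e [a [g [[ad ge dek] [pg loc]]]]]] := Hs p.
have hg : is_homog g by exists e.
(* J is closed under sums because a point avoiding w + w' avoids w or w'; this
   replaces the choice of a finite subcover. *)
pose J w := exists N, forall q : point f, ~ q v -> ~ q w ->
  germ q (g ^+ N) * (s q * germ q g - germ q a) = 0.
have upN N N' (q : point f) : (N <= N')%N ->
    germ q (g ^+ N) * (s q * germ q g - germ q a) = 0 ->
    germ q (g ^+ N') * (s q * germ q g - germ q a) = 0.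
  by move=> le E; rewrite -(subnK le) exprD rmorphM -mulrA E mulr0.
have [|||m [N JN]] := @point_cover _ f J v _ _ hv iv; last first.
- exists (g ^+ N.+1), (g ^+ N * a); split; first exact: is_homogX.
    by move/ptX.
  move=> q qv; have /eqP := JN q qv (fun H => qv (ptX H)).
  by rewrite mulrBr subr_eq0 exprSr !rmorphM => /eqP <-; ring.
- move=> p' p'v; have [d' [e' [a' [g' [[ad' ge' dek'] [pg' loc']]]]]] := Hs p'.
  have hg' : is_homog g' by exists e'.
  exists g'; split=> //.
  have [||q|L [c E]] := @germ_vanish (g * g' * v) (a' * g - a * g').
  + by do 2 apply: is_homogM => //.
  + exact: in_irrelevantMl.
  + move=> qN; have qg : ~ q g by move=> ?; apply: qN; rewrite -mulrA mulrC; apply: pt_M.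
    have qg' : ~ q g'.
      by move=> ?; apply: qN; rewrite mulrC mulrA; apply: pt_M.
    by rewrite rmorphB !rmorphM /= -(loc q qg) -(loc' q qg'); ring.
  exists L => q qv qg'.
  (* One factor g' clears the denominator of s = a' / g'; the others, with v^L, complete g^L to (g
     g' v)^L. *)
  apply: (@germI q (g' ^+ L.+1 * v ^+ L)).
  + by apply: is_homogM; apply: is_homogX.
  + by move=> /pt_prime[/ptX|/ptX].
  have := congr1 (germ q) E; rewrite !rmorphM /= germF mulr0 mul0r => <-.
  rewrite rmorphB !rmorphM !rmorphXn /= !rmorphM exprS -(loc' q qg').
  by rewrite !exprMn; ring.
- by exists 0%N => q _ /(_ (pt_form q)).
- split; first by exists 0%N => q _ /(_ (pt_0 q)).
    move=> x y [N HN] [M HM]; exists (N + M)%N => q qv qxy.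
    have [qx|qx] := pselect (q x); last by apply: upN (HN q qv qx); rewrite leq_addr.
    apply: upN (HM q qv _); first by rewrite leq_addl.
    by move=> qy; apply: qxy; apply: pt_D.
  by move=> c x [N HN]; exists N => q qv qcx; apply: HN => // qx; apply/qcx/pt_M.
Qed.

(** The denominators of [s] valid on all of D(v) form an ideal, which contains a power of [v] by
    [section_near] and quasi-compactness. Its numerator need not be homogeneous, so one component of
    it is kept. *)
Lemma section_affine k (s : stalks f) v dv :
  is_section k s -> v \is dv.-homog -> (0 < dv)%N -> in_irrelevant v -> exists m d b,
    [/\ b \is d.-homog, d%:Z = (m * dv)%N%:Z + k &
        forall q : point f, ~ q v -> s q * germ q (v ^+ m) = germ q b].
Proof.
move=> Hs vd dv0 iv; have hv : is_homog v by exists dv.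
pose J u := exists b, forall q : point f, ~ q v -> s q * germ q u = germ q b.
have [|||m [b0 Jm]] := @point_cover _ f J v _ _ hv iv.
- split; first by exists 0 => q _; rewrite !rmorph0 mulr0.
    move=> x y [b Hb] [c Hc]; exists (b + c) => q qv.
    by rewrite !rmorphD /= mulrDr Hb // Hc.
  by move=> a x [b Hb]; exists (a * b) => q qv; rewrite !rmorphM /= -Hb //; ring.
- by exists 0 => q _; rewrite germF rmorph0 mulr0.
- move=> p pv; have [u [b [hu pu E]]] := section_near Hs hv iv pv.
  by exists u; split=> //; exists b.
(* Enlarging the exponent by |k| keeps the degree of the numerator nonnegative when k < 0. *)
have [D ED] : exists D : nat, D%:Z = ((m + absz k) * dv)%N%:Z + k.
  exists (absz (((m + absz k) * dv)%N%:Z + k)); nia.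
pose m' := (m + absz k)%N.
have [b Eb] : exists b, forall q : point f, ~ q v -> s q * germ q (v ^+ m') = germ q b.
  by exists (b0 * v ^+ absz k) => q qv; rewrite exprD !rmorphM /= mulrA Jm.
exists m', D, (pihomog mdeg D b); split=> //; first exact: pihomogP.
move=> q qv.
have /sectionP/(_ q)[d [e [a [g [[ad ge dek] [pg loc]]]]]] := Hs.
have hg : is_homog g by exists e.
apply: (germI hg pg); rewrite mulrAC loc // -rmorphM -rmorphM /=.
apply/eqP; rewrite -subr_eq0 -rmorphB; apply/eqP/germ_eq0.
have /germ_eq0[u [c [[r ur] qu E]]] : germ q (a * v ^+ m' - b * g) = 0.
  by rewrite rmorphB !rmorphM /= -(loc q pg) -Eb //; ring.
(* In this degree u a v^m' is unchanged, while u g is homogeneous of degree r + e, so only the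
   component of degree [D] of [b] survives. *)
have := congr1 (pihomog mdeg (r + (e + D))) E.
have ghom : u * g \is (r + e).-homog by apply: dhomogM.
have -> : u * (a * v ^+ m' - b * g) = u * (a * v ^+ m') - (u * g) * b by ring.
rewrite raddfB /= [X in X - _]pihomog_dE; last first.
  have -> : (e + D = d + dv * m')%N by rewrite /m'; nia.
  by do 2 apply: dhomogM => //; apply: dhomogMn.
rewrite addnA (comp_homogM _ _ ghom) leq_addr addKn.
rewrite [c * F]mulrC (comp_homogM _ _ (form_poly_homog f)) => E'.
have [c' Ec] : exists c', u * (a * v ^+ m') - u * g * pihomog mdeg D b = c' * F.
  by rewrite E'; case: ifP => _; [eexists; rewrite mulrC | exists 0; rewrite mul0r].
exists u, c'; split=> //; first by exists r.
by rewrite -Ec; ring.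
Qed.

End Germs.

(** * Coordinates in which the form has a nonzero leading coefficient *)

Definition affine_form m (g : bform m) : {poly int} :=
  \poly_(i < m.+1) cf g (m - i).

(** Coordinates in which [f] becomes [g], with [cev] the substitution X = t, Y = 1. The points and
    stalks remain those of [f]: a change of coordinates takes the place of an isomorphism between
    S_f and S_g. *)
Record chart n (f g : bform n) := Chart {
  cX : ZXY;
  cY : ZXY;
  cev : {rmorphism ZXY -> {poly int}};
  cX1 : cX \is 1.-homog;
  cY1 : cY \is 1.-homog;
  cX_irr : in_irrelevant cX;
  cY_irr : in_irrelevant cY;
  cXY : forall p : point f, ~ (p cX /\ p cY);
  cevX : cev cX = 'X;
  cevY : cev cY = 1;
  cev_size : forall d a, a \is d.-homog -> (size (cev a) <= d.+1)%N;
  cev_inj : forall d a b, a \is d.-homog -> b \is d.-homog -> cev a = cev b -> a = b;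
  cev_form : cev (form_poly f) = affine_form g }.

Lemma mpoly2_ext (S : pzRingType) (phi psi : {rmorphism ZXY -> S}) :
  phi vX = psi vX -> phi vY = psi vY -> phi =1 psi.
Proof.
move=> EX EY p; rewrite [p]mpolyE !rmorph_sum /=; apply: eq_bigr => m _.
rewrite -[p@_m]intz scaler_int !rmorphMz /=; congr (_ *~ _).
rewrite mpolyXE_id !big_ord_recl big_ord0 mulr1 !rmorphM !rmorphXn /=.
have -> : lift ord0 ord0 = 1 :> 'I_2 by apply: val_inj.
by rewrite [phi 'X_ord0]EX [phi 'X_1]EY.
Qed.

Section LinSubst.
Implicit Types M N : 'M[int]_2.

Lemma lin_subst_is_zmod_morphism M : zmod_morphism (lin_subst M).
Proof. by move=> p q; apply: rmorphB. Qed.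
Lemma lin_subst_is_monoid_morphism M : monoid_morphism (lin_subst M).
Proof. by split=> [|p q]; [apply: rmorph1 | apply: rmorphM]. Qed.
HB.instance Definition _ M :=
  GRing.isZmodMorphism.Build ZXY ZXY (lin_subst M) (lin_subst_is_zmod_morphism M).
HB.instance Definition _ M :=
  GRing.isMonoidMorphism.Build ZXY ZXY (lin_subst M) (lin_subst_is_monoid_morphism M).

Lemma lin_substX M : lin_subst M vX = M 0 0 *: vX + M 0 1 *: vY.
Proof. by rewrite /lin_subst comp_mpolyXU -tnth_nth tnth_mktuple. Qed.

Lemma lin_substY M : lin_subst M vY = M 1 0 *: vX + M 1 1 *: vY.
Proof. by rewrite /lin_subst comp_mpolyXU -tnth_nth tnth_mktuple. Qed.

Lemma lin_substZ M c p : lin_subst M (c *: p) = c *: lin_subst M p.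
Proof. exact: comp_mpolyZ. Qed.

Lemma lin_substM M N p : lin_subst N (lin_subst M p) = lin_subst (M *m N) p.
Proof.
have E i : M i 0 *: (N 0 0 *: vX + N 0 1 *: vY) + M i 1 *: (N 1 0 *: vX + N 1 1 *: vY)
    = (M *m N) i 0 *: vX + (M *m N) i 1 *: vY.
  have two (F : 'I_2 -> int) : \sum_j F j = F 0 + F 1.
    by rewrite !big_ord_recl big_ord0 addr0; congr (_ + F _); apply: val_inj.
  by rewrite !mxE !two !scalerDr !scalerDl !scalerA addrACA.
apply: (mpoly2_ext (phi := lin_subst N \o lin_subst M)) => /=.
  by rewrite !lin_substX rmorphD /= !lin_substZ lin_substX lin_substY.
by rewrite !lin_substY rmorphD /= !lin_substZ lin_substX lin_substY.
Qed.

Lemma lin_subst1 p : lin_subst 1%:M p = p.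
Proof.
apply: (mpoly2_ext (phi := lin_subst 1%:M) (psi := idfun)) => /=.
  by rewrite lin_substX !mxE /= scale1r scale0r addr0.
by rewrite lin_substY !mxE /= scale1r scale0r add0r.
Qed.

Lemma vX_homog : vX \is 1.-homog. Proof. by rewrite dhomogX /= mdeg1. Qed.
Lemma vY_homog : vY \is 1.-homog. Proof. by rewrite dhomogX /= mdeg1. Qed.

Lemma lin_subst_homog M d p : p \is d.-homog -> lin_subst M p \is d.-homog.
Proof.
move=> /dhomogP pd; rewrite [p]mpolyE rmorph_sum /= big_seq.
apply: rpred_sum => m /pd /= <-; rewrite lin_substZ; apply: dhomogZ.
rewrite mpolyXE_id rmorph_prod mdegE !big_ord_recl !big_ord0 /= !rmorphXn /=.
have L a b : a *: vX + b *: vY \is 1.-homog.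
  by apply: rpredD; apply: dhomogZ; [apply: vX_homog | apply: vY_homog].
have -> : lift ord0 ord0 = 1 :> 'I_2 by apply: val_inj.
rewrite mulr1 addn0 [lin_subst M 'X_ord0]lin_substX [lin_subst M 'X_1]lin_substY.
by apply: dhomogM; apply: homog1X; apply: L.
Qed.

End LinSubst.

Definition dehomog : ZXY -> {poly int} :=
  mmap polyC (fun i : 'I_2 => if i == 0 then 'X else 1).
HB.instance Definition _ := GRing.RMorphism.on dehomog.

Lemma dehomogX : dehomog vX = 'X.
Proof. by rewrite /dehomog /vX mmapX mmap1U. Qed.

Lemma dehomogY : dehomog vY = 1.
Proof. by rewrite /dehomog /vY mmapX mmap1U. Qed.

Lemma dehomogXm m : dehomog 'X_[m] = 'X^(m 0).
Proof.
by rewrite /dehomog mmapX /mmap1 !big_ord_recl big_ord0 /= expr1n !mulr1.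
Qed.

Lemma dehomogZ c p : dehomog (c *: p) = c *: dehomog p.
Proof. by rewrite /dehomog mmapZ mul_polyC. Qed.

Lemma dehomog_size d p : p \is d.-homog -> (size (dehomog p) <= d.+1)%N.
Proof.
move=> /dhomogP pd; rewrite [p]mpolyE rmorph_sum /= big_seq.
apply: (leq_trans (size_sum _ _ _)); apply/bigmax_leqP_seq => m mp _.
have [/pd /= <-|] := boolP (m \in msupp p); last by rewrite mp.
rewrite dehomogZ dehomogXm (leq_trans (size_scale_leq _ _)) //.
by rewrite size_polyXn ltnS mdegE !big_ord_recl leq_addr.
Qed.

Lemma dehomogK d p : p \is d.-homog ->
  p = \sum_(i < d.+1) (dehomog p)`_i *: (vX ^+ i * vY ^+ (d - i)).
Proof.
move=> /dhomogP pd; rewrite {1 2}[p]mpolyE rmorph_sum /=.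
under [RHS]eq_bigr => i _ do rewrite coef_sum scaler_suml.
rewrite exchange_big /= [LHS]big_seq [RHS]big_seq; apply: eq_bigr => m mp.
have dm := pd m mp; have lt : (m 0%R < d.+1)%N.
  by rewrite -dm ltnS /= mdegE !big_ord_recl leq_addr.
rewrite (bigD1 (Ordinal lt)) //= big1 => [|i ne]; last first.
  rewrite dehomogZ dehomogXm coefZ coefXn.
  suff /negbTE -> : nat_of_ord i != m 0 by rewrite mulr0 scale0r.
  by apply: contra ne => /eqP E; apply/eqP/val_inj.
rewrite addr0 dehomogZ dehomogXm coefZ coefXn eqxx mulr1; congr (_ *: _).
rewrite mpolyXE_id !big_ord_recl big_ord0 mulr1 -dm /= mdegE !big_ord_recl big_ord0.
have -> : lift ord0 ord0 = 1 :> 'I_2 by apply: val_inj.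
by rewrite addn0 addKn.
Qed.

Lemma chart_of_model n (f f' : bform n) : model_form f f' -> inhabited (chart f f').
Proof.
have ch : GL2_transform f f' -> inhabited (chart f f').
  move=> [M Mu EF]; set N := invmx M; constructor.
  have NM : N *m M = 1%:M by apply: mulVmx.
  have MN : M *m N = 1%:M by apply: mulmxV.
  have irr a b : in_irrelevant (a *: vX + b *: vY).
    by exists a%:MP, b%:MP; rewrite !mul_mpolyC.
  (* The new coordinates are the linear forms that the substitution by [M] turns into x and y. *)
  refine (@Chart n f f' (lin_subst N vX) (lin_subst N vY)
    (dehomog \o lin_subst M) _ _ _ _ _ _ _ _ _ _).
  - exact/lin_subst_homog/vX_homog.
  - exact/lin_subst_homog/vY_homog.
  - by rewrite lin_substX.
  - by rewrite lin_substY.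
  - move=> p [pX pY]; apply: (@pt_irrelevant _ _ p).
    have co a b : p (a *: lin_subst N vX + b *: lin_subst N vY).
      by apply: pt_D; rewrite -mul_mpolyC; apply: pt_M.
    have back v : lin_subst N (lin_subst M v) = v by rewrite lin_substM MN lin_subst1.
    split; [rewrite -(back vX) lin_substX | rewrite -(back vY) lin_substY];
      by rewrite rmorphD /= !lin_substZ.
  - by rewrite /= lin_substM NM lin_subst1 dehomogX.
  - by rewrite /= lin_substM NM lin_subst1 dehomogY.
  - by move=> d a ad; apply/dehomog_size/lin_subst_homog.
  - move=> d a b /(lin_subst_homog M) ad /(lin_subst_homog M) bd /= E.
    have /(congr1 (lin_subst N)) : lin_subst M a = lin_subst M b.
      by rewrite (dehomogK ad) E -(dehomogK bd).
    by rewrite !lin_substM MN !lin_subst1.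
  - rewrite /= -EF /form_poly rmorph_sum /affine_form poly_def /=.
    rewrite (reindex_inj rev_ord_inj) /=; apply: eq_bigr => i _.
    rewrite subSS dehomogZ rmorphM !rmorphXn /= dehomogX dehomogY expr1n mulr1.
    by rewrite subKn ?leq_ord.
(* The case f' = f is the transform by the identity matrix. *)
rewrite /model_form; case: ifP => [_ E|_ [/ch]//]; apply: ch; rewrite E.
by exists 1%:M; [apply: unitmx1 | rewrite lin_subst1].
Qed.

(** * Polynomials that glue *)

Section Gluable.
Variables (n : nat) (g : bform n).
Implicit Types P Q R H : {poly int}.
Hypothesis g0 : cf g 0 != 0.
Local Notation G := (affine_form g).

(* P glues to a section of degree K - 1: on D(X) it has a pole of order N along X,
   modulo the form. *)
Definition gluable (K : nat) (P : {poly int}) : Prop :=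
  exists (N : nat) (Q H : {poly int}), 'X^N * P = Q + H * G /\ (size Q <= N + K)%N.

Lemma size_affine_form : size G = n.+1.
Proof. by rewrite /affine_form size_poly_eq // subnn. Qed.

Lemma affine_form_neq0 : G != 0.
Proof. by rewrite -size_poly_eq0 size_affine_form. Qed.

Lemma size_mul_form P : P != 0 -> size (P * G) = (size P + n)%N.
Proof. by move=> P0; rewrite size_mul ?affine_form_neq0 // size_affine_form addnS. Qed.

Lemma size_XnM_leq m (P : {poly int}) : (size ('X^m * P)%R <= m + size P)%N.
Proof. by apply: leq_trans (size_polyMleq _ _) _; rewrite size_polyXn. Qed.

(** Multiplying the relation by t^m gives two polynomials a common exponent, or makes the exponent
    positive. *)
Lemma gluable_shift K P m : gluable K P -> exists (N : nat) (Q H : {poly int}),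
  [/\ (m <= N)%N, 'X^N * P = Q + H * G & (size Q <= N + K)%N].
Proof.
move=> [N [Q [H [E sQ]]]]; exists (m + N)%N, ('X^m * Q), ('X^m * H).
split; first exact: leq_addr.
  by rewrite exprD -mulrA E mulrDr mulrA.
by rewrite -addnA (leq_trans (size_XnM_leq _ _)) // leq_add2l.
Qed.

Lemma gluableD K P P' : gluable K P -> gluable K P' -> gluable K (P + P').
Proof.
move=> gP [N' [Q' [H' [E' sQ']]]].
have [N [Q [H [NN' E sQ]]]] := gluable_shift N' gP.
exists N, (Q + 'X^(N - N') * Q'), (H + 'X^(N - N') * H'); split.
  by rewrite mulrDr E -{1}(subnK NN') exprD -mulrA E'; ring.
apply: leq_trans (size_polyD _ _) _; rewrite geq_max sQ /=.
by apply: leq_trans (size_XnM_leq _ _) _; lia.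
Qed.

Lemma gluableZ K (c : int) P : gluable K P -> gluable K (c *: P).
Proof.
move=> [N [Q [H [E sQ]]]]; exists N, (c *: Q), (c *: H).
rewrite -scalerAr E scalerDr scalerAl; split=> //.
exact: leq_trans (size_scale_leq _ _) sQ.
Qed.

Lemma gluableM K L P P' :
  gluable K.+1 P -> gluable L.+1 P' -> gluable (K + L).+1 (P * P').
Proof.
move=> [N [Q [H [E sQ]]]] [N' [Q' [H' [E' sQ']]]].
exists (N + N')%N, (Q * Q'), (H * Q' + (Q + H * G) * H'); split.
  have -> : 'X^(N + N') * (P * P') = ('X^N * P) * ('X^N' * P') by rewrite exprD; ring.
  by rewrite E E'; ring.
by apply: leq_trans (size_polyMleq _ _) _; lia.
Qed.

Lemma gluable_small K P : (size P <= K)%N -> gluable K P.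
Proof. by exists 0%N, P, 0; rewrite mul1r mul0r addr0. Qed.

(** Modulo G, t^j times the truncation is minus the part of G of degree below j, which is small
    enough even for [K] = 0. *)
Lemma gluable_drop K j : gluable K (drop_poly j G).
Proof.
exists j, (- take_poly j G), 1; split.
  by rewrite mul1r -{3}(poly_take_drop j G) addKr mulrC.
by rewrite size_polyN (leq_trans (size_take_poly _ _)) ?leq_addr.
Qed.

Lemma drop_polyXnM N i (P : {poly int}) : (i <= N)%N ->
  drop_poly N ('X^i * P) = drop_poly (N - i) P.
Proof.
move=> iN; apply/polyP => j; rewrite !coef_drop_poly coefXnM.
by rewrite ltnNge (leq_trans iN (leq_addl _ _)) /= -addnBA.
Qed.

(* The splitting of H at degree N is the computation of H^1(P^1, O(K - 1 - n)). *)
Lemma gluable_span K P : (K <= n)%N -> gluable K P ->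
  exists (H : {poly int}) (a : nat -> int),
    P = H * G + \sum_(0 <= m < n)
          a m *: (if (m < K)%N then 'X^m else drop_poly (n - m) G).
Proof.
move=> Kn [N [Q [H [E sQ]]]].
pose e m : {poly int} := if (m < K)%N then 'X^m else drop_poly (n - m) G.
pose span P := exists a : nat -> int, P = \sum_(0 <= m < n) a m *: e m.
have span0 : span 0 by exists (fun=> 0); rewrite big1 // => m _; rewrite scale0r.
have spanD x y : span x -> span y -> span (x + y).
  move=> [a ->] [b ->]; exists (fun m => a m + b m).
  by rewrite -big_split /=; apply: eq_bigr => m _; rewrite scalerDl.
have spanZ c x : span x -> span (c *: x).
  move=> [a ->]; exists (fun m => c * a m).
  by rewrite scaler_sumr; apply: eq_bigr => m _; rewrite scalerA.
have span_sum k (F : 'I_k -> {poly int}) : (forall i, span (F i)) -> span (\sum_i F i).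
  by move=> sF; elim/big_ind: _.
have span_e m : (m < n)%N -> span (e m).
  move=> mn; exists (fun j => (j == m)%:R).
  rewrite (bigD1_seq m) ?mem_index_iota ?iota_uniq //= eqxx scale1r.
  by rewrite big1 ?addr0 // => j /negbTE ->; rewrite scale0r.
have span_small R : (size R <= K)%N -> span R.
  move=> sR; rewrite -(coefK R) poly_def; apply: span_sum => i; apply: spanZ.
  have iK := leq_trans (ltn_ord i) sR.
  by have := span_e i (leq_trans iK Kn); rewrite /e iK.
(* For j > n the truncation is zero; if its degree n - j is below [K], powers of t span it;
   otherwise it belongs to the family. *)
have span_drop j : (0 < j)%N -> span (drop_poly j G).
  move=> j0; have [nj|jn] := ltnP n j.
    by rewrite drop_poly_eq0 // size_affine_form.
  have [s|KN] := ltnP (n - j) K.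
    by apply: span_small; rewrite size_drop_poly size_affine_form; lia.
  have : span (e (n - j)%N) by apply: span_e; lia.
  by rewrite /e ltnNge KN /= subKn.
suff [a Ea] : span (P - drop_poly N H * G).
  by exists (drop_poly N H), a; rewrite -Ea addrC subrK.
(* The terms of [H] of degree at least N are absorbed in the multiple of G. Division by t^N turns
   [Q] into a polynomial of size at most [K], and t^i G with i < N into a truncation. *)
have -> : P - drop_poly N H * G = drop_poly N (Q + take_poly N H * G).
  rewrite -[LHS](drop_polyMXn_id N); congr drop_poly.
  rewrite mulrBl mulrC E -[in H * G](poly_take_drop N H); ring.
rewrite drop_polyD; apply: spanD.
  by apply: span_small; rewrite size_drop_poly leq_subLR.
rewrite /take_poly poly_def mulr_suml raddf_sum /=; apply: span_sum => i.
rewrite -scalerAl drop_polyZ; apply: spanZ.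
by rewrite drop_polyXnM ?(ltnW (ltn_ord i)) //; apply: span_drop; rewrite subn_gt0.
Qed.

(** Over the rationals (t^N H' - H) G = Q has size at most N + K <= N + n, so t^N H' - H has size at
    most N. The coefficients of H' are thus coefficients of [H], hence integers. Gauss's lemma would
    not do, as G may fail to be primitive. *)
Lemma gluable_dvd K P (H' : {poly rat}) : (K <= n)%N -> gluable K P ->
  map_poly intr P = H' * map_poly intr G -> exists H, P = H * G.
Proof.
move=> Kn [N [Q [H [E sQ]]]] EP; exists (drop_poly N H).
pose iota := map_poly (intr : int -> rat).
have iota_inj : injective iota.
  by apply: map_inj_poly => // x y /eqP; rewrite eqr_int => /eqP.
have si R : size (iota R) = size R.
  by rewrite size_map_inj_poly // => x y /eqP; rewrite eqr_int => /eqP.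
have siG : size (iota G) = n.+1 by rewrite si size_affine_form.
have ED : ('X^N * H' - iota H) * iota G = iota Q.
  have := congr1 iota E.
  rewrite /iota rmorphM rmorphD rmorphM /= map_polyXn EP => E'.
  by rewrite mulrBl -mulrA E' addrK.
have sD : (size ('X^N * H' - iota H)%R <= N)%N.
  have [->|D0] := eqVneq ('X^N * H' - iota H) 0; first by rewrite size_poly0.
  have iG0 : iota G != 0 by rewrite -size_poly_eq0 siG.
  have := congr1 (fun R : {poly rat} => size R) ED.
  rewrite size_mul // siG si addnS /= => sDn.
  by rewrite -(leq_add2r n) sDn (leq_trans sQ) // leq_add2l.
apply: iota_inj; rewrite /iota EP rmorphM /=; congr (_ * _).
apply/polyP => i; rewrite coef_map coef_drop_poly /=.
have /(leq_sizeP _ _)/(_ (i + N)%N (leq_addl _ _))/eqP := sD.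
by rewrite coefB coefXnM coef_map ltnNge leq_addl addnK subr_eq0 => /eqP.
Qed.

End Gluable.

(** * Sections and polynomials *)

Section Represents.
Variables (n : nat) (f g : bform n) (c : chart f g).
Hypothesis g0 : cf g 0 != 0.
Local Notation F := (form_poly f).
Local Notation G := (affine_form g).
Local Notation X := (cX c).
Local Notation Y := (cY c).
Local Notation ev := (cev c).
Implicit Types (P Q R H : {poly int}) (s t : stalks f) (p q : point f).

(* On D(Y), the section s of degree k is Y^k P(X/Y). *)
Definition represents (k : int) s P : Prop :=
  is_section k s /\
  exists d m b, [/\ b \is d.-homog, d%:Z = m%:Z + k, ev b = P &
    forall q, ~ q Y -> s q * germ q (Y ^+ m) = germ q b].

Lemma homogX : is_homog X. Proof. by exists 1%N; apply: cX1. Qed.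
Lemma homogY : is_homog Y. Proof. by exists 1%N; apply: cY1. Qed.

Lemma evYn m : ev (Y ^+ m) = 1. Proof. by rewrite rmorphXn /= cevY expr1n. Qed.
Lemma evXn m : ev (X ^+ m) = 'X^m. Proof. by rewrite rmorphXn /= cevX. Qed.

Lemma homogenize d P : (size P <= d.+1)%N -> exists2 b, b \is d.-homog & ev b = P.
Proof.
move=> sP; exists (\sum_(i < d.+1) P`_i *: (X ^+ i * Y ^+ (d - i))).
  apply: rpred_sum => i _; apply: dhomogZ.
  have H : X ^+ i * Y ^+ (d - i) \is (i + (d - i)).-homog.
    by apply: dhomogM; apply: homog1X; [apply: cX1 | apply: cY1].
  by move: H; rewrite subnKC // leq_ord.
have evC (z : int) : ev z%:MP = z%:~R by rewrite -{1}[z]intz !rmorph_int.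
rewrite rmorph_sum /= -{2}(coefK P) poly_def.
rewrite (big_ord_widen _ (fun i => P`_i *: 'X^i) sP) [RHS]big_mkcond /=.
apply: eq_bigr => i _; rewrite -mul_mpolyC !rmorphM /= evXn evYn mulr1.
rewrite evC; case: ltnP => [_|sPi]; last by rewrite nth_default // mul0r.
by rewrite mulrzl -[in RHS](intz P`_i) scaler_int.
Qed.

(* G has degree exactly n since g_0 <> 0, so quotients dehomogenize without loss. *)
Lemma form_dvd d a H : a \is d.-homog -> ev a = H * G -> exists r, a = r * F.
Proof.
move=> ad E; have [H0|H0] := eqVneq H 0.
  exists 0; rewrite mul0r; apply: (cev_inj (c := c) ad (rpred0 _)).
  by rewrite E H0 mul0r rmorph0.
have := cev_size c ad; rewrite E size_mul_form // => sH.
have Hpos : (0 < size H)%N by rewrite size_poly_gt0.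
have [|r rd Er] := @homogenize (d - n) H; first lia.
exists r; apply: (cev_inj (c := c) ad); last by rewrite rmorphM /= cev_form Er.
have -> : d = (d - n + n)%N by lia.
by apply: dhomogM => //; apply: form_poly_homog.
Qed.

Lemma germ_dvd q a r : a = r * F -> germ q a = 0.
Proof. by move->; rewrite rmorphM /= germF mulr0. Qed.

Lemma notY_X p : p Y -> ~ p X.
Proof. by move=> pY pX; exact: (@cXY _ _ _ c p). Qed.

(* Y is a nonzerodivisor modulo F, because g_0 <> 0. *)
Lemma section_eq0 k s : is_section k s -> (forall q, ~ q Y -> s q = 0) -> s = 0.
Proof.
move=> Hs s0; apply: functional_extensionality_dep => p.
have [pY|/s0//] := pselect (p Y); have pX := notY_X pY.
have [m [d [b [bd Ed sX]]]] := section_affine Hs (cX1 c) isT (cX_irr c).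
have [||q qXY|M [r E]] := @germ_vanish _ f (X * Y) b.
- exact: is_homogM homogX homogY.
- exact/in_irrelevantMl/cY_irr.
- have qX : ~ q X by move=> ?; apply: qXY; rewrite mulrC; apply: pt_M.
  have qY : ~ q Y by move=> ?; apply/qXY/pt_M.
  by rewrite -sX // s0 // mul0r.
(* The factor Y^M in the relation dehomogenizes to 1 and drops out. *)
have [r' Er'] : exists r', X ^+ M * b = r' * F.
  apply: (@form_dvd (M + d) _ (ev r)); first by apply: dhomogM => //; apply/homog1X/cX1.
  rewrite -(cev_form c) -rmorphM -E exprMn !rmorphM /= evYn mulr1 //.
have pXm i : ~ p (X ^+ i) by move/ptX.
apply: (germI (is_homogX (m + M) homogX) (pXm _)).
rewrite exprD rmorphM mulrA sX // mul0r mulrC -rmorphM /=.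
exact: germ_dvd Er'.
Qed.

(** After cross-multiplication the numerators differ by an element that a power of Y kills modulo F,
    and Y dehomogenizes to 1. *)
Lemma represents_uniq k s P P' : represents k s P -> represents k s P' ->
  exists H, P - P' = H * G.
Proof.
move=> [_ [d [m [b [bd Ed <- sb]]]]] [_ [d' [m' [b' [bd' Ed' <- sb']]]]].
have [||q qY|M [r E]] := @germ_vanish _ f Y (b * Y ^+ m' - b' * Y ^+ m).
- exact: homogY.
- exact: cY_irr.
- by rewrite rmorphB !rmorphM /= -sb // -sb' //; ring.
exists (ev r); have := congr1 ev E.
by rewrite !rmorphM /= cev_form rmorphB !rmorphM /= !evYn !mulr1 mul1r.
Qed.

Lemma represents_exists k s : is_section k s -> exists P, represents k s P.
Proof.
move=> Hs; have [m [d [b [bd Ed sb]]]] := section_affine Hs (cY1 c) isT (cY_irr c).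
by exists (ev b); split=> //; exists d, m, b; split=> //; rewrite Ed muln1.
Qed.

Lemma representsB k s t P Q :
  represents k s P -> represents k t Q -> represents k (s - t) (P - Q).
Proof.
move=> [Hs [d [m [b [bd Ed <- sb]]]]] [Ht [d' [m' [b' [bd' Ed' <- tb]]]]].
split; first exact: section_B.
have E : (d + m' = d' + m)%N by lia.
exists (d + m')%N, (m + m')%N, (b * Y ^+ m' - b' * Y ^+ m); split.
- by apply: rpredB; [|rewrite E]; apply: dhomogM => //; apply/homog1X/cY1.
- by rewrite !PoszD Ed; ring.
- by rewrite rmorphB !rmorphM /= !evYn !mulr1.
move=> q qY; rewrite -[(s - t) q]/(s q - t q) rmorphB exprD !rmorphM /= -sb // -tb //.
by ring.
Qed.

Lemma representsM k l s t P Q :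
  represents k s P -> represents l t Q -> represents (k + l) (s * t) (P * Q).
Proof.
move=> [Hs [d [m [b [bd Ed <- sb]]]]] [Ht [d' [m' [b' [bd' Ed' <- tb]]]]].
split; first exact: section_M.
exists (d + d')%N, (m + m')%N, (b * b'); split.
- exact: dhomogM.
- by rewrite !PoszD Ed Ed'; ring.
- by rewrite rmorphM.
move=> q qY; rewrite -[(s * t) q]/(s q * t q) exprD !rmorphM /= -sb // -tb //.
by ring.
Qed.

Lemma represents1 : represents 0 1 1.
Proof.
split; first exact: section_1.
exists 0%N, 0%N, 1; split=> //; first exact: dhomog1.
  by rewrite rmorph1.
by move=> q _; rewrite -[(1 : stalks f) q]/(1 : loc _) mul1r expr0.
Qed.

(** Comparing the fractions on D(Y) and D(X) over D(XY) and setting X = t, Y = 1 gives the relation;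
    the numerator a over X^N has degree N + k, whence the bound. *)
Lemma represents_gluable k K s P : K%:Z = k + 1 -> represents k s P -> gluable g K P.
Proof.
move=> EK [Hs [d [m [b [bd Ed <- sb]]]]].
have [N [e [a [ae Ee sa]]]] := section_affine Hs (cX1 c) isT (cX_irr c).
have [||q qXY|M [r E]] := @germ_vanish _ f (X * Y) (b * X ^+ N - a * Y ^+ m).
- exact: is_homogM homogX homogY.
- exact/in_irrelevantMl/cY_irr.
- have qX : ~ q X by move=> ?; apply: qXY; rewrite mulrC; apply: pt_M.
  have qY : ~ q Y by move=> ?; apply/qXY/pt_M.
  by rewrite rmorphB !rmorphM /= -sb // -sa //; ring.
exists (M + N)%N, ('X^M * ev a), (ev r); split.
  have := congr1 ev E.
  rewrite !rmorphM /= cev_form exprMn rmorphM rmorphB !rmorphM /= !evXn !evYn => E'.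
  rewrite -E' exprD; ring.
apply: leq_trans (size_XnM_leq _ _) _; rewrite -addnA leq_add2l.
by apply: leq_trans (cev_size c ae) _; lia.
Qed.

(** Homogenizing t^N P = Q + H G gives fractions b / Y^m on D(Y) and a / X^N on D(X) that agree on
    the overlap. *)
Lemma gluable_represents k K P : K%:Z = k + 1 -> gluable g K P ->
  exists s, represents k s P.
Proof.
move=> EK /(gluable_shift 1)[N [Q [H [N1 EP sQ]]]].
(* Large enough to homogenize [P] in degree m + k; like N, it is positive, so that m + k >= 0 even
   for k = -1 and D(Y^m) = D(Y). *)
pose m := (size P).+1.
have [|b bd Eb] := @homogenize (m + K).-1 P; first by rewrite /m; lia.
have [|a ad Ea] := @homogenize (N + K).-1 Q; first lia.
have [r Er] : exists r, b * X ^+ N - a * Y ^+ m = r * F.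
  apply: (@form_dvd (m + K + N).-1 _ H).
    apply: rpredB.
      have -> : ((m + K + N).-1 = (m + K).-1 + N)%N by lia.
      by apply: dhomogM => //; apply/homog1X/cX1.
    have -> : ((m + K + N).-1 = (N + K).-1 + m)%N by lia.
    by apply: dhomogM => //; apply/homog1X/cY1.
  by rewrite rmorphB !rmorphM /= evXn evYn Eb Ea mulrC EP; ring.
have ba q : germ q b * germ q (X ^+ N) = germ q a * germ q (Y ^+ m).
  by apply/eqP; rewrite -subr_eq0 -!rmorphM -rmorphB; apply/eqP/(germ_dvd q Er).
pose s : stalks f := fun q =>
  if pselect (q Y) then Defs.frac _ a (X ^+ N) else Defs.frac _ b (Y ^+ m).
have sY q : ~ q Y -> s q * germ q (Y ^+ m) = germ q b.
  move=> qY; have qYm : ~ q (Y ^+ m) by move/ptX.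
  apply/(fracP _ _ (is_homogX m homogY) qYm).
  by rewrite /s; case: pselect.
have sX q : ~ q X -> s q * germ q (X ^+ N) = germ q a.
  move=> qX; have qXN : ~ q (X ^+ N) by move/ptX.
  have [qY|qY] := pselect (q Y).
    by apply/(fracP _ _ (is_homogX N homogX) qXN); rewrite /s; case: pselect.
  have qYm : ~ q (Y ^+ m) by move/ptX.
  by apply: (germI (is_homogX m homogY) qYm); rewrite mulrAC sY // ba.
have pos j v q : (0 < j)%N -> ~ q (v ^+ j) -> ~ q v.
  by case: j => // j _ nq qv; apply: nq; rewrite exprSr; apply: pt_M.
exists s; split; last by exists (m + K).-1, m, b; split=> //; lia.
apply/sectionP => p; have [pY|pY] := pselect (p Y).
  have pX := notY_X pY.
  exists (N + K).-1, N, a, (X ^+ N); split.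
    by split=> //; [apply/homog1X/cX1 | lia].
  by split=> [/ptX//|q /(pos _ _ _ N1)/sX].
exists (m + K).-1, m, b, (Y ^+ m); split.
  by split=> //; [apply/homog1X/cY1 | lia].
by split=> [/ptX//|q /(pos m _ _ isT)/sY].
Qed.

Lemma represents_eq0 k K s P (U : {poly rat}) :
  K%:Z = k + 1 -> (K <= n)%N -> represents k s P ->
  map_poly intr P = U * map_poly intr G -> s = 0.
Proof.
move=> EK Kn Hs EP.
have [H E] := gluable_dvd g0 Kn (represents_gluable EK Hs) EP.
have [secs [d [m [b [bd Ed Eb sb]]]]] := Hs.
apply: (section_eq0 secs) => q qY.
have qYm : ~ q (Y ^+ m) by move/ptX.
apply: (germI (is_homogX m homogY) qYm); rewrite mul0r sb //.
by have [r] := form_dvd bd (etrans Eb E); apply: germ_dvd.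
Qed.

End Represents.

(** * The lattices R_f, I_f^k and I_f^# in Q_f *)

Section Lattices.
Variables (n : nat) (g : bform n).
Hypotheses (n0 : (0 < n)%N) (g0 : cf g 0 != 0).
Local Notation G := (affine_form g).
Implicit Types (P Q R H : {poly int}) (x y : Qf g).

Definition at_theta P : Qf g := in_qpoly _ (map_poly intr P).

Lemma at_theta_is_zmod_morphism : zmod_morphism at_theta.
Proof. by move=> P Q; rewrite /at_theta !rmorphB. Qed.
Lemma at_theta_is_monoid_morphism : monoid_morphism at_theta.
Proof. by split=> [|P Q]; rewrite /at_theta ?rmorph1 // !rmorphM. Qed.
HB.instance Definition _ :=
  GRing.isZmodMorphism.Build {poly int} (Qf g) at_theta at_theta_is_zmod_morphism.
HB.instance Definition _ :=
  GRing.isMonoidMorphism.Build {poly int} (Qf g) at_theta at_theta_is_monoid_morphism.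

Lemma at_thetaX : at_theta 'X = theta g.
Proof. by rewrite /at_theta map_polyX. Qed.

Lemma at_thetaZ (c : int) P : at_theta (c *: P) = at_theta P *~ c.
Proof. by rewrite -[c in LHS]intz scaler_int rmorphMz. Qed.

Lemma dehomE : dehom g = map_poly intr G.
Proof.
apply/polyP => i; rewrite coef_map !coef_poly /=.
by case: ifP => // _; rewrite mulr0z.
Qed.

(** The monic modulus of Q_f is g_0^-1 G, which generates the same ideal over the rationals. *)
Lemma at_theta_eq0 P : at_theta P = 0 <->
  exists U : {poly rat}, map_poly intr P = U * map_poly intr G.
Proof.
have g0Q : (cf g 0)%:~R != 0 :> rat by rewrite intr_eq0.
have mon := monic_mk_monic ((cf g 0)%:~R^-1 *: dehom g).
split=> [/(congr1 val) /= E|[U E]].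
  have := Pdiv.RingMonic.rdivp_eq mon (map_poly intr P).
  rewrite E addr0 (Qf_modulus n0 g0) dehomE => {1}->.
  by eexists; rewrite -scalerAr scalerAl.
apply: val_inj; rewrite /= E.
have -> : map_poly intr G =
    (cf g 0)%:~R *: mk_monic ((cf g 0)%:~R^-1 *: dehom g) :> {poly rat}.
  by rewrite (Qf_modulus n0 g0) scalerA divff // scale1r dehomE.
by rewrite -scalerAr scalerAl; apply: Pdiv.RingMonic.rmodp_mull.
Qed.

Lemma at_theta_dvd P : at_theta (P * G) = 0.
Proof. by apply/at_theta_eq0; exists (map_poly intr P); rewrite rmorphM. Qed.

Lemma at_theta_drop m : (m <= n)%N -> at_theta (drop_poly (n - m) G) = xi g m.
Proof.
move=> mn; have -> : drop_poly (n - m) G = \poly_(i < m.+1) cf g (m - i).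
  apply/polyP => i; rewrite coef_drop_poly !coef_poly.
  have -> : (i + (n - m) < n.+1)%N = (i < m.+1)%N by lia.
  by case: ltnP => // im; congr (cf g _); lia.
rewrite poly_def rmorph_sum /xi (reindex_inj rev_ord_inj) /=.
apply: eq_bigr => i _.
by rewrite subSS subKn ?leq_ord // at_thetaZ rmorphXn /= at_thetaX.
Qed.

(** The expected image of the sections of degree K - 1 in Q_f: [K] = 0, 1, k + 1 will give I_f^#,
    R_f, I_f^k. *)
Definition lattice (K : nat) x : Prop := exists2 P, gluable g K P & x = at_theta P.

Lemma latticeD K x y : lattice K x -> lattice K y -> lattice K (x + y).
Proof.
move=> [P gP ->] [Q gQ ->]; exists (P + Q); first exact: gluableD.
by rewrite rmorphD.
Qed.

Lemma latticez K x (a : int) : lattice K x -> lattice K (x *~ a).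
Proof. by move=> [P gP ->]; exists (a *: P); [apply: gluableZ | rewrite at_thetaZ]. Qed.

Lemma lattice0 K : lattice K 0.
Proof. by exists 0; [apply: gluable_small; rewrite size_poly0 | rewrite rmorph0]. Qed.

Lemma lattice_int K (a : int) : lattice K.+1 a%:~R.
Proof.
apply: latticez; exists 1; last by rewrite rmorph1.
by apply: gluable_small; rewrite size_poly1.
Qed.

Lemma lattice_sum K (I : eqType) (r : seq I) (E : I -> Qf g) :
  (forall i, i \in r -> lattice K (E i)) -> lattice K (\sum_(i <- r) E i).
Proof.
move=> LE; rewrite big_seq; elim/big_ind: _ => //; first exact: lattice0.
exact: latticeD.
Qed.

Lemma latticeM K L x y :
  lattice K.+1 x -> lattice L.+1 y -> lattice (K + L).+1 (x * y).
Proof.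
move=> [P gP ->] [Q gQ ->]; exists (P * Q); first exact: gluableM.
by rewrite rmorphM.
Qed.

Lemma lattice_xi K m : (m <= n)%N -> lattice K (xi g m).
Proof.
by move=> mn; exists (drop_poly (n - m) G); [apply: gluable_drop | rewrite at_theta_drop].
Qed.

Lemma lattice_span K x : (K <= n)%N -> lattice K x -> exists a : nat -> int,
  x = \sum_(0 <= m < n) (if (m < K)%N then theta g ^+ m else xi g m) *~ a m.
Proof.
move=> Kn [P /(gluable_span g0 Kn)[H [a ->]] ->]; exists a.
rewrite rmorphD /= at_theta_dvd add0r rmorph_sum /= big_seq [RHS]big_seq.
apply: eq_bigr => m; rewrite mem_index_iota => /andP[_ mn].
rewrite at_thetaZ; congr (_ *~ _); case: ifP => _.
  by rewrite rmorphXn /= at_thetaX.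
exact/at_theta_drop/ltnW.
Qed.

Lemma Rf_xi m : (m <= n)%N -> Rf g (xi g m).
Proof. by move=> mn; rewrite xiE; apply: Rf_D; [apply: Rf_zeta | apply: Rf_int]. Qed.

(** Each zeta_m differs from xi_m by the integer g_m, so 1 and the xi_m span R_f. *)
Lemma Rf_lattice x : Rf g x <-> lattice 1 x.
Proof.
split=> [[a ->]|Lx].
  apply: latticeD; first exact: lattice_int.
  apply: lattice_sum => m; rewrite mem_index_iota => /andP[_ /ltnW mn].
  apply: latticez; have -> : zeta g m = xi g m + (- cf g m)%:~R.
    by rewrite xiE mulrNz addrK.
  by apply: latticeD; [apply: lattice_xi | apply: lattice_int].
have [a ->] := lattice_span n0 Lx; apply: Rf_sum => m /andP[_ mn].
apply: Rf_z; case: ifP => [|_]; last exact/Rf_xi/ltnW.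
by rewrite ltnS leqn0 => /eqP ->; apply: Rf_1.
Qed.

Lemma Ifsharp_lattice x : Ifsharp g x <-> lattice 0 x.
Proof.
split=> [[a ->]|Lx]; last by have [a ->] := lattice_span (leq0n _) Lx; exists a.
apply: lattice_sum => m; rewrite mem_index_iota => /andP[_ /ltnW mn].
exact/latticez/lattice_xi.
Qed.

Lemma sm_mul_mem (A : comPzRingType) (S : subring A) (M N : submod S) u v :
  M u -> N v -> sm_mul M N (u * v).
Proof.
by move=> Mu Nv; exists 1%N, (fun=> u), (fun=> v); split=> //; rewrite big_ord1.
Qed.

Lemma If_1 : If g 1.
Proof. by exists 1, 0; split; [apply: Rf_1 | apply: Rf_0 | rewrite mul0r addr0]. Qed.

Lemma If_theta : If g (theta g).
Proof. by exists 0, 1; split; [apply: Rf_0 | apply: Rf_1 | rewrite mul1r add0r]. Qed.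

Lemma sm_exp_theta k m : (m <= k)%N -> sm_exp (If g) k (theta g ^+ m).
Proof.
elim: k m => [|k IHk] [|m] => //; try by move=> *; apply: Rf_1.
  have Ek := @sm_mul_mem _ _ (If g) (sm_exp (If g) k) 1 1.
  by move=> _; rewrite expr0 -(mulr1 1); apply: Ek; [apply: If_1 | apply: (IHk 0%N)].
rewrite ltnS exprS => mk; have Ek := @sm_mul_mem _ _ (If g) (sm_exp (If g) k).
by apply: Ek; [apply: If_theta | apply: IHk].
Qed.

(** Forward, I_f lies in the lattice of index 2 and degrees add under products. Backward, theta^m
    with m <= k is a product of k generators of I_f, and xi_m lies in R_f, hence in I_f^k since 1 is
    in I_f. *)
Lemma sm_exp_lattice k x : (k < n)%N -> sm_exp (If g) k x <-> lattice k.+1 x.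
Proof.
move=> kn; split=> [|/(lattice_span kn)[a ->]].
  elim: k x {kn} => [|k IHk] x; first by move/Rf_lattice.
  move=> [m [u [v [uv ->]]]]; apply: lattice_sum => i _; have [Iu Ev] := uv i.
  apply: (@latticeM 1 k); last exact: IHk.
  have L2 r : Rf g r -> lattice 2 r.
    move=> /Rf_lattice[P [N [Q [H [E sQ]]]] ->].
    exists P => //; exists N, Q, H; split=> //; lia.
  have [r [r' [/L2 Rr /Rf_lattice Rr' ->]]] := Iu.
  apply: latticeD => //; apply: (@latticeM 0 1) => //.
  by exists 'X; [apply: gluable_small; rewrite size_polyX | rewrite at_thetaX].
apply/sm_predP; rewrite big_seq; apply: rpred_sum => m.
rewrite mem_index_iota => /andP[_ mn]; apply: rpredMz; apply/sm_predP.
case: ifP => [mk|_]; first exact: (@sm_exp_theta k m mk).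
rewrite -(mulr1 (xi g m)); apply: sm_Z; first exact/Rf_xi/ltnW.
exact: (@sm_exp_theta k 0).
Qed.

End Lattices.

(** * The ring and module isomorphisms *)

Lemma inj_surj_bij (T U : Type) (h : T -> U) :
  injective h -> (forall u, exists t, h t = u) -> bijective h.
Proof.
move=> hI /choice[h' hK]; exists h' => // t.
exact/hI/hK.
Qed.

Section Isomorphisms.
Variables (n : nat) (f g : bform n) (c : chart f g).
Hypotheses (n0 : (0 < n)%N) (g0 : cf g 0 != 0).
Implicit Types (s t : stalks f) (x y : Qf g).

(** A relation, since [P] is determined only modulo G. It respects the operations; once it is shown
    functional in both directions, choice turns it into isomorphisms. *)
Definition matches (k : int) s x : Prop :=
  exists2 P, represents c k s P & x = at_theta g P.

Lemma matches_section k s x : matches k s x -> is_section k s.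
Proof. by move=> [P [] ]. Qed.

Lemma matchesB k s t x y :
  matches k s x -> matches k t y -> matches k (s - t) (x - y).
Proof.
move=> [P sP ->] [Q tQ ->]; exists (P - Q); first exact: representsB.
by rewrite rmorphB.
Qed.

Lemma matchesM k l s t x y :
  matches k s x -> matches l t y -> matches (k + l) (s * t) (x * y).
Proof.
move=> [P sP ->] [Q tQ ->]; exists (P * Q); first exact: representsM.
by rewrite rmorphM.
Qed.

Lemma matches1 : matches 0 1 1.
Proof. by exists 1; [apply: represents1 | rewrite rmorph1]. Qed.

Lemma matches_funl k s x y : matches k s x -> matches k s y -> x = y.
Proof.
move=> [P sP ->] [Q sQ ->]; have [H E] := represents_uniq sP sQ.
by apply/eqP; rewrite -subr_eq0 -rmorphB /= E at_theta_dvd.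
Qed.

(** The difference of the sections is represented by a rational multiple of G; gluing makes it an
    integral multiple, hence zero. *)
Lemma matches_funr k K s t x : K%:Z = k + 1 -> (K <= n)%N ->
  matches k s x -> matches k t x -> s = t.
Proof.
move=> EK Kn sx tx; have [P stP /esym] := matchesB sx tx.
rewrite subrr => /(at_theta_eq0 n0 g0)[U E].
by apply/eqP; rewrite -subr_eq0; apply/eqP/(represents_eq0 g0 EK Kn stP E).
Qed.

Lemma matches_lattice k K s : K%:Z = k + 1 -> is_section k s ->
  exists2 x, lattice K x & matches k s x.
Proof.
move=> EK /(represents_exists c)[P sP]; exists (at_theta g P); last by exists P.
by exists P => //; apply: represents_gluable sP.
Qed.

Lemma lattice_matches k K x : K%:Z = k + 1 -> lattice K x -> exists s, matches k s x.
Proof.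
by move=> EK [P /(gluable_represents c g0 EK)[s sP] ->]; exists s, P.
Qed.

(** Each morphism law holds because both sides match the same element of Q_f. The clause on
    [matches] serves to prove linearity over this [phi]. *)
Lemma ring_iso : exists phi : {rmorphism Rf g -> GammaO f},
  bijective phi /\ forall r, matches 0 (val (phi r)) (val r).
Proof.
have E1 : 1%N%:Z = 0 + 1 :> int by [].
have ex (r : Rf g) : exists s : GammaO f, matches 0 (val s) (val r).
  have /(Rf_lattice n0 g0)/(lattice_matches E1)[s sr] := (sr_predP _ _).1 (valP r).
  have Hs : s \in sr_pred (GammaO f) by apply/sr_predP/(matches_section sr).
  by exists (SrType Hs).
have [phi phiP] := choice ex.
have funr (s t : GammaO f) x : matches 0 (val s) x -> matches 0 (val t) x -> s = t.
  by move=> sx tx; apply/val_inj/(matches_funr E1 n0 sx tx).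
have phiB : zmod_morphism phi.
  move=> r r'; apply: (funr _ _ (val (r - r'))); first exact: phiP.
  exact: (matchesB (phiP r) (phiP r')).
have phiM : monoid_morphism phi.
  split=> [|r r']; first by apply: (funr _ _ 1); [apply: phiP | apply: matches1].
  apply: (funr _ _ (val (r * r'))); first exact: phiP.
  by have := matchesM (phiP r) (phiP r'); rewrite addr0.
pose phiB' := GRing.isZmodMorphism.Build _ _ phi phiB.
pose phiM' := GRing.isMonoidMorphism.Build _ _ phi phiM.
pose phiR : {rmorphism Rf g -> GammaO f} := HB.pack phi phiB' phiM'.
exists phiR; split=> //; apply: inj_surj_bij => [r r' E|s].
  apply: val_inj; apply: (@matches_funl 0 (val (phi r))); first exact: phiP.
  by rewrite [phi r]E; apply: phiP.
have [x /(Rf_lattice n0 g0) Rx sx] :=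
  matches_lattice E1 ((sr_predP _ _).1 (valP s)).
have Hx : x \in sr_pred (Rf g) by apply/sr_predP.
exists (SrType Hx); apply: (funr _ _ x) => //; exact: (phiP (SrType Hx)).
Qed.

Lemma module_iso (phi : {rmorphism Rf g -> GammaO f}) (k : int) (K : nat)
    (M : submod (Rf g)) :
  (forall r, matches 0 (val (phi r)) (val r)) ->
  K%:Z = k + 1 -> (K <= n)%N -> (forall x, M x <-> lattice K x) ->
  exists psi : {linear M -> GammaOk f k | phi \; *:%R}, bijective psi.
Proof.
move=> phiP EK Kn ML.
have ex (u : M) : exists s : GammaOk f k, matches k (val s) (val u).
  have /ML/(lattice_matches EK)[s su] := (sm_predP _ _).1 (valP u).
  have Hs : s \in sm_pred (GammaOk f k) by apply/sm_predP/(matches_section su).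
  by exists (SmType Hs).
have [psi psiP] := choice ex.
have funr (s t : GammaOk f k) x : matches k (val s) x -> matches k (val t) x -> s = t.
  by move=> sx tx; apply/val_inj/(matches_funr EK Kn sx tx).
have psiB : zmod_morphism psi.
  move=> u v; apply: (funr _ _ (val (u - v))); first exact: psiP.
  exact: (matchesB (psiP u) (psiP v)).
have psiZ : scalable_for (phi \; *:%R) psi.
  move=> r u; apply: (funr _ _ (val (r *: u))); first exact: psiP.
  by have := matchesM (phiP r) (psiP u); rewrite add0r.
pose psiB' := GRing.isZmodMorphism.Build _ _ psi psiB.
pose psiZ' := GRing.isScalable.Build _ _ _ _ psi psiZ.
pose psiL : {linear M -> GammaOk f k | phi \; *:%R} := HB.pack psi psiB' psiZ'.
exists psiL; apply: inj_surj_bij => [u v E|s].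
  apply: val_inj; apply: (@matches_funl k (val (psi u))); first exact: psiP.
  by rewrite [psi u]E; apply: psiP.
have [x /ML Mx sx] := matches_lattice EK ((sm_predP _ _).1 (valP s)).
have Hx : x \in sm_pred M by apply/sm_predP.
exists (SmType Hx); apply: (funr _ _ x) => //; exact: (psiP (SmType Hx)).
Qed.

End Isomorphisms.

Theorem theorem2p7 (n : nat) (hn : (1 <= n)%N) (f : bform n) (hf : f != 0)
    (f' : bform n) (hf' : model_form f f') :
  exists phi : {rmorphism Rf f' -> GammaO f},
    [/\ bijective phi,
        forall k : nat, (1 <= k <= n - 1)%N ->
          exists psi : {linear sm_exp (If f') k -> GammaOk f k%:Z | phi \; *:%R},
            bijective psi
      & exists psi : {linear Ifsharp f' -> GammaOk f (-1) | phi \; *:%R},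
          bijective psi].
Proof.
have [c] := chart_of_model hf'.
have g0 : cf f' 0 != 0 by move: hf'; rewrite /model_form; case: ifP => [? ->|_ []].
have [phi [phib phiP]] := ring_iso c hn g0.
exists phi; split=> // [k /andP[_ kn]|].
  (* The bound k <= n - 1 is exactly [K <= n]. *)
  apply: (module_iso hn g0 phiP (K := k.+1)); [lia | lia | move=> x].
  by apply: sm_exp_lattice => //; lia.
by apply: (module_iso hn g0 phiP (K := 0)) => // x; apply: Ifsharp_lattice.
Qed.
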